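(* Let $V_1=Sp(2)/SU(2)$ be equipped with the normal homogeneous metric described in the context, and let $\gamma$ be a unit-speed geodesic of $V_1$ with $\gamma(0)=o$. Then the covariant derivatives at $\gamma(0)$ of the Jacobi operator along $\gamma$ satisfy: (i) $R^{2n)}_0=(-1)^{n-1}R^{2)}_0$ for all integers $n\ge1$; (ii) $R^{2n+1)}_0=(-1)^{n}R^{1)}_0$ for all integers $n\ge0$.
   Context: The manifold $V_1$. Let $E_{kl}$ be the $4\times4$ matrix units. $sp(2)$ is the real Lie algebra of skew-Hermitian $4\times 4$ matrices $$\begin{pmatrix}a_{11}&a_{12}&a_{13}&a_{14}\\-\overline a_{12}&-a_{11}&\overline a_{14}&-\overline a_{13}\\-\overline a_{13}&-a_{14}&a_{33}&a_{34}\\-\overline a_{14}&a_{13}&-\overline a_{34}&-a_{33}\end{pmatrix}$$ with $a_{11},a_{33}$ purely imaginary and the other $a_{ij}$ complex. Put $S_1=i(E_{11}-E_{22})$, $S_2=i(E_{33}-E_{44})$, $S_3=E_{12}-E_{21}$, $S_4=i(E_{12}+E_{21})$, $S_5=E_{34}-E_{43}$, $S_6=i(E_{34}+E_{43})$, $S_7=E_{13}-E_{31}-E_{24}+E_{42}$, $S_8=i(E_{13}+E_{31}+E_{24}+E_{42})$, $S_9=E_{14}-E_{41}+E_{23}-E_{32}$, $S_{10}=i(E_{14}+E_{41}-E_{23}-E_{32})$, and $Q_1=\frac12S_1-\frac32S_2$, $Q_2=\sqrt{5/2}\,S_3$, $Q_3=\sqrt{5/2}\,S_4$, $Q_4=\frac{\sqrt6}2S_5-\frac{\sqrt2}2S_7$,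 $Q_5=\frac{\sqrt6}2S_6-\frac{\sqrt2}2S_8$, $Q_6=\frac{\sqrt5}2S_9$, $Q_7=\frac{\sqrt5}2S_{10}$, $Q_8=\frac32S_1+\frac12S_2$, $Q_9=S_5+\frac{\sqrt3}2S_7$, $Q_{10}=S_6+\frac{\sqrt3}2S_8$. The inner product $\langle A,B\rangle=-\frac15\mathrm{Tr}(AB)$ on $sp(2)$ is $\mathrm{Ad}(Sp(2))$-invariant and $\{Q_1,\dots,Q_{10}\}$ is orthonormal. $\mathbf h=\mathrm{span}\{Q_8,Q_9,Q_{10}\}\cong su(2)$ is the Lie algebra of the subgroup $H\cong SU(2)$ of $Sp(2)$, and $\mathbf m=\mathrm{span}\{Q_1,\dots,Q_7\}$ is its orthogonal complement, identified with $T_oV_1$, where $o$ is the coset of $H$. $V_1=Sp(2)/H$ carries the $Sp(2)$-invariant Riemannian metric induced by $\langle\cdot,\cdot\rangle|_{\mathbf m}$ (a normal homogeneous space). Jacobi operator. $\nabla$ is the Levi-Civita connection and $R$ its curvature tensor, $R(X,Y)Z=\nabla_X\nabla_YZ-\nabla_Y\nabla_XZ-\nabla_{[X,Y]}Z$. Along $\gamma$, $R_t=R(\cdot,\gamma')\gamma'(t)$ and $R^{i)}_t=(\nabla_{\gamma'}\cdots\nabla_{\gamma'}R)(\cdot,\gamma')\gamma'(t)$ ($i$ covariant derivatives of $R$); $R^{i)}_0$ is the value at $t=0$, an endomorphism of $T_oV_1$. *)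

(* Defs.v *)
From HB Require Import structures.
From mathcomp Require Import all_boot all_order all_algebra.
From mathcomp Require Import complex.
From mathcomp Require Import all_classical all_reals all_analysis.

Set Implicit Arguments.
Unset Strict Implicit.
Unset Printing Implicit Defensive.

Import Order.TTheory GRing.Theory Num.Theory.
Import numFieldNormedType.Exports.

Local Open Scope classical_set_scope.
Local Open Scope complex_scope.
Local Open Scope ring_scope.

(* Meant for finite-dimensional V and open U, where existence and continuity
   of all iterated directional derivatives is C^k regularity. *)
Fixpoint Ck_on (R : realType) (V W : normedModType R) (k : nat) (U : set V)
    (f : V -> W) : Prop :=
  (forall x, U x -> {for x, continuous f}) /\
  if k is k'.+1 then
    forall v : V, (forall x, U x -> derivable f x v) /\
                  Ck_on k' U (fun x => 'D_v f x)
  else True.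

Definition smooth_on (R : realType) (V W : normedModType R) (U : set V)
    (f : V -> W) : Prop :=
  forall k, Ck_on k U f.

(* Riemannian geometry on an open subset U of the coordinate space V; tangent
   vectors at every point of U are elements of V, vector fields are maps
   V -> V, of which only the values on U matter. *)
Section coordinate_geometry.
Variables (R : realType) (V : normedModType R).

(* G x u v is the covariant derivative at x of the constant field v in the
   direction u: its components are the Christoffel symbols. *)
Definition covD (G : V -> V -> V -> V) (X Y : V -> V) : V -> V :=
  fun x => 'D_(X x) Y x + G x (X x) (Y x).

Definition lie (X Y : V -> V) : V -> V :=
  fun x => 'D_(X x) Y x - 'D_(Y x) X x.

Definition affine_connection (U : set V) (G : V -> V -> V -> V) : Prop :=
  (forall u v, smooth_on U (fun x => G x u v)) /\
  (forall x, U x ->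
     (forall a u v w, G x (a *: u + v) w = a *: G x u w + G x v w) /\
     (forall a u v w, G x u (a *: v + w) = a *: G x u v + G x u w)).

Definition levi_civita (U : set V) (g : V -> V -> V -> R)
    (G : V -> V -> V -> V) : Prop :=
  [/\ affine_connection U G,
      forall X Y, smooth_on U X -> smooth_on U Y ->
        forall x, U x -> covD G X Y x - covD G Y X x = lie X Y x
    & forall X Y Z, smooth_on U X -> smooth_on U Y -> smooth_on U Z ->
        forall x, U x ->
          'D_(X x) (fun y => g y (Y y) (Z y)) x =
          g x (covD G X Y x) (Z x) + g x (Y x) (covD G X Z x)].

Definition curvature (G : V -> V -> V -> V) (X Y Z : V -> V) : V -> V :=
  fun x => covD G X (covD G Y Z) x - covD G Y (covD G X Z) x
           - covD G (lie X Y) Z x.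

(* The curvature is a tensor, so its value on tangent vectors can be computed
   with any extension to vector fields; we take the constant ones. *)
Definition Riem (G : V -> V -> V -> V) (x u v w : V) : V :=
  curvature G (cst u) (cst v) (cst w) x.

Definition covDt (G : V -> V -> V -> V) (c : R -> V) (Y : R -> V) : R -> V :=
  fun t => derive1 Y t + G (c t) (derive1 c t) (Y t).

(* Covariant derivative along c of a (1,3)-tensor field T along c: Leibniz rule
   on T(X,Y)Z, the value being independent of the fields X, Y, Z along c that
   extend u, v, w; we take the constant ones. *)
Definition covDt_tensor (G : V -> V -> V -> V) (c : R -> V)
    (T : R -> V -> V -> V -> V) : R -> V -> V -> V -> V :=
  fun t u v w =>
    covDt G c (fun s => T s u v w) t
    - T t (covDt G c (cst u) t) v w
    - T t u (covDt G c (cst v) t) w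
    - T t u v (covDt G c (cst w) t).

Definition jacobi_op (G : V -> V -> V -> V) (c : R -> V) (i : nat) (t : R)
    (u : V) : V :=
  iter i (covDt_tensor G c) (fun s => Riem G (c s)) t u (derive1 c t) (derive1 c t).

End coordinate_geometry.

Section manifold_V1.
Variable R : realType.
Local Notation M4 := 'M[R[i]]_4.
Local Notation V := 'rV[R]_7.
Local Notation I := ('i%C : R[i]).
Local Notation r := (real_complex R).

(* matrix units with indices starting from 1 *)
Definition E (k l : nat) : M4 := delta_mx (inord k.-1) (inord l.-1).

Definition S1 : M4 := I *: (E 1 1 - E 2 2).
Definition S2 : M4 := I *: (E 3 3 - E 4 4).
Definition S3 : M4 := E 1 2 - E 2 1.
Definition S4 : M4 := I *: (E 1 2 + E 2 1).
Definition S5 : M4 := E 3 4 - E 4 3.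
Definition S6 : M4 := I *: (E 3 4 + E 4 3).
Definition S7 : M4 := E 1 3 - E 3 1 - E 2 4 + E 4 2.
Definition S8 : M4 := I *: (E 1 3 + E 3 1 + E 2 4 + E 4 2).
Definition S9 : M4 := E 1 4 - E 4 1 + E 2 3 - E 3 2.
Definition S10 : M4 := I *: (E 1 4 + E 4 1 - E 2 3 - E 3 2).

Definition Q1 : M4 := r (1 / 2) *: S1 - r (3 / 2) *: S2.
Definition Q2 : M4 := r (Num.sqrt (5 / 2)) *: S3.
Definition Q3 : M4 := r (Num.sqrt (5 / 2)) *: S4.
Definition Q4 : M4 := r (Num.sqrt 6 / 2) *: S5 - r (Num.sqrt 2 / 2) *: S7.
Definition Q5 : M4 := r (Num.sqrt 6 / 2) *: S6 - r (Num.sqrt 2 / 2) *: S8.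
Definition Q6 : M4 := r (Num.sqrt 5 / 2) *: S9.
Definition Q7 : M4 := r (Num.sqrt 5 / 2) *: S10.
Definition Q8 : M4 := r (3 / 2) *: S1 + r (1 / 2) *: S2.
Definition Q9 : M4 := S5 + r (Num.sqrt 3 / 2) *: S7.
Definition Q10 : M4 := S6 + r (Num.sqrt 3 / 2) *: S8.

(* The trace is real on sp(2); taking the real part only fixes the type. *)
Definition ip (A B : M4) : R := - (1 / 5) * complex.Re (\tr (A *m B)).

Definition h_alg : set M4 :=
  [set A | exists a b c : R, A = r a *: Q8 + r b *: Q9 + r c *: Q10].

(* orthogonal projection of sp(2) onto m, whose orthonormal basis is Q1..Q7 *)
Definition pr_m (A : M4) : M4 :=
  \sum_(Q <- [:: Q1; Q2; Q3; Q4; Q5; Q6; Q7]) r (ip A Q) *: Q.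

(* Sp(2) = {g unitary, g^T J g = J}. The diagonal blocks of elements of sp(2)
   are [a, b; -b^*, a^*] while the off-diagonal ones are [p, q; q^*, -p^*];
   this is the choice J = diag(j, -j), j = [0, 1; -1, 0], for the symplectic
   form: A is in sp(2) iff A is skew-Hermitian and A^T J + J A = 0. *)
Definition Jsp : M4 := E 1 2 - E 2 1 - E 3 4 + E 4 3.

Definition Sp2 : set M4 :=
  [set g | g \is unitarymx /\ g^T *m Jsp *m g = Jsp].

Definition mexp (A : M4) : M4 :=
  limn (fun n => \sum_(k < n) (k`!%:R : R[i])^-1 *: A ^+ k).

(* H is the connected Lie subgroup with Lie algebra h: the subgroup generated
   by exp(h) (closed under inverses because h_alg = - h_alg). *)
Inductive H_grp : M4 -> Prop :=
| H_one : H_grp 1%:M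
| H_mul (g A : M4) : H_grp g -> h_alg A -> H_grp (g *m mexp A).

Definition coset (g : M4) : set M4 := [set g *m k | k in H_grp].

Definition V1 : set (set M4) := [set coset g | g in Sp2].

Definition base_point : set M4 := coset 1%:M.

(* Real and imaginary parts are taken entrywise so that derivatives are those
   of maps between real normed spaces. *)
Definition smooth_mx (U : set V) (f : V -> M4) : Prop :=
  smooth_on U (fun x => map_mx (@complex.Re R) (f x) : 'M[R]_4) /\
  smooth_on U (fun x => map_mx (@complex.Im R) (f x) : 'M[R]_4).

Definition diff_mx (f : V -> M4) (x u : V) : M4 :=
  map_mx (real_complex R) ('D_u (fun y => map_mx (@complex.Re R) (f y) : 'M[R]_4) x)
  + I *: map_mx (real_complex R)
           ('D_u (fun y => map_mx (@complex.Im R) (f y) : 'M[R]_4) x).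

(* For sigma : V -> Sp(2), translating by sigma(x)^-1 the differential at x of
   x |-> sigma(x)H gives this linear map from V to T_o V_1 = m. *)
Definition theta (sigma : V -> M4) (x u : V) : M4 :=
  pr_m (invmx (sigma x) *m diff_mx sigma x u).

(* Local parametrizations x |-> sigma(x)H of V_1, given through a smooth lift
   sigma to Sp(2) (which always exists locally); dim V = dim m = 7, so
   injectivity of theta makes them local diffeomorphisms. *)
Definition is_chart (U : set V) (sigma : V -> M4) : Prop :=
  [/\ open U,
      smooth_mx U sigma,
      forall x, U x -> Sp2 (sigma x),
      forall x, U x -> forall u, theta sigma x u = 0 -> u = 0
    & forall x y, U x -> U y -> coset (sigma x) = coset (sigma y) -> x = y].

(* The Sp(2)-invariant metric with value <.,.> on T_o V_1 = m, read in a
   chart. *)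
Definition metric (sigma : V -> M4) (x u v : V) : R :=
  ip (theta sigma x u) (theta sigma x v).

(* c is the coordinate expression, over the open set W of parameters, of a
   curve gamma in V_1. *)
Definition coord_curve (U : set V) (sigma : V -> M4) (gamma : R -> set M4)
    (W : set R) (c : R -> V) : Prop :=
  open W /\ forall s, W s -> U (c s) /\ gamma s = coset (sigma (c s)).

Definition unit_speed_geodesic (J : set R) (gamma : R -> set M4) : Prop :=
  forall t, J t -> V1 (gamma t) /\
  forall U sigma x, is_chart U sigma -> U x -> gamma t = coset (sigma x) ->
  exists W c,
    [/\ W t, coord_curve U sigma gamma W c, smooth_on W c,
        forall G, levi_civita U (metric sigma) G ->
          forall s, W s -> covDt G c (derive1 c) s = 0
      & forall s, W s -> metric sigma (c s) (derive1 c s) (derive1 c s) = 1].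

End manifold_V1.

(* Main.v *)
Require Import Defs.
From HB Require Import structures.
From mathcomp Require Import all_boot all_order all_algebra.
From mathcomp Require Import complex.
From mathcomp Require Import all_classical all_reals all_analysis.
From mathcomp Require Import perm ring lra.
Set Implicit Arguments.
Unset Strict Implicit.
Unset Printing Implicit Defensive.
Import Order.TTheory GRing.Theory Num.Theory.
Import numFieldNormedType.Exports.
Local Open Scope classical_set_scope.
Local Open Scope ring_scope.

(** The tangent bundle of a chart is trivialized by the Maurer-Cartan form: for
    the lift sigma to Sp(2) put omega = sigma^-1 d sigma, which takes its values
    in sp(2) = h + m, and write theta and eta for its components in m and h.  The
    form theta identifies each tangent space with m isometrically, and
    d omega (u, v) = - [omega u, omega v] turns the geometry into Lie algebra.

    - In this frame the Levi-Civita connection is d + Lam(omega), where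
      Lam(X) Z = [X_h, Z] + 1/2 [X_m, Z]_m: this is torsion free by the
      Maurer-Cartan equation and metric because the scalar product is
      ad-invariant, hence it is the one given by Koszul's formula
      (connection_frame).
    - Its curvature is a trilinear map on m that does not depend on the point
      and is h-equivariant (riem_frame).
    - Along a geodesic the velocity a = theta(gamma') satisfies a' = - [eta, a].
      Differentiating an h-equivariant expression in a and in fields of the frame
      therefore only leaves the term 1/2 [a, .]_m of the connection, so that the
      i-th covariant derivative of the curvature is obtained from the curvature
      by i applications of the derivation L = 1/2 [a, .]_m (jet_frame).  Since
      L a = 0, the Jacobi operators satisfy J_(i+1) = [L, J_i] (jacS).

    What is special about V_1 is that [., .]_m is the cross product of R^7
    (pm7_cross): [a, [a, x]_m]_m = <a, x> a - |a|^2 x.  For a unit vector a this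
    says that 2 L is a complex structure on the orthogonal complement of a, and
    J_0 maps a to 0 and m into this complement.  There ad_L has the eigenvalues
    0 and +-i only, hence J_3 = - J_1 (jac3), and both claims follow by applying
    ad_L repeatedly.

    The calculus that this needs is that of functions all of whose iterated
    directional derivatives exist and are continuous: symmetry of the second
    derivatives (schwarz), which gives both the Maurer-Cartan equation and the
    curvature formula, and differentiability (C1_differentiable), which gives
    linearity in the direction and the chain rule along curves. *)

(** * Directional derivatives and C^k functions *)

Section line.
Context {R : realType} {V W : normedModType R}.

Lemma is_derive_line (f : V -> W) (x v : V) (t : R) :
  derivable f (t *: v + x) v ->
  is_derive t 1 (fun s : R => f (s *: v + x)) ('D_v f (t *: v + x)).
Proof.
have E : (fun h : R => h^-1 *: (f ((h *: (1:R) + t) *: v + x) - f (t *: v + x)))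
  = (fun h : R => h^-1 *: (f (h *: v + (t *: v + x)) - f (t *: v + x))).
  by apply/funext => h; rewrite scalerDl -addrA [h *: 1]mulr1.
move=> d; split; first by rewrite /derivable /= E.
by rewrite /derive /= E.
Qed.
End line.

Section mvt.
Context {R : realType} {V : normedModType R}.

(** A step s of either sign is allowed, so that an increment along a coordinate
    axis can be treated without distinguishing cases. *)
Lemma mvt_line (f : V -> R) (x v : V) (s : R) :
  (forall t, `|t| <= `|s| -> derivable f (t *: v + x) v) ->
  exists2 t, `|t| <= `|s| & f (s *: v + x) - f x = s * 'D_v f (t *: v + x).
Proof.
move=> df.
have der (t : R) : `|t| <= `|s| ->
    is_derive t 1 (fun s : R => f (s *: v + x)) ('D_v f (t *: v + x)).
  by move=> /df; exact: is_derive_line.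
have cont a b : (forall t, t \in `[a, b] -> `|t| <= `|s|) ->
    {within `[a, b], continuous (fun s : R => f (s *: v + x))}.
  move=> H; by apply: derivable_within_continuous => t /H /der[].
have [s0|s0] := lerP 0 s.
- have H t : t \in `[0, s] -> `|t| <= `|s|.
    by rewrite in_itv /= => /andP[t0 ts]; rewrite !ger0_norm.
  have [t|t tI E] := MVT_segment s0 _ (cont _ _ H) (df := fun t => 'D_v f (t *: v + x)).
    by move=> tI; apply: der; apply: H; exact: subset_itv_oo_cc.
  by exists t; [exact: H | move: E; rewrite scale0r add0r subr0 mulrC].
- have H t : t \in `[s, 0] -> `|t| <= `|s|.
    by rewrite in_itv /= => /andP[t0 ts]; rewrite !ler0_norm ?lerN2 // ltW.
  have [t|t tI E] := MVT_segment (ltW s0) _ (cont _ _ H) (df := fun t => 'D_v f (t *: v + x)).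
    by move=> tI; apply: der; apply: H; exact: subset_itv_oo_cc.
  exists t; first exact: H.
  by rewrite -opprB -[X in _ - X]/(f (s *: v + x)) -{1}[x]add0r -[in X in X + x](scale0r v) E sub0r mulrN opprK mulrC.
Qed.

End mvt.

Lemma open_eq_near {T : topologicalType} {W : Type} (U : set T) (f g : T -> W) x :
  open U -> U x -> (forall y, U y -> f y = g y) -> \near x, f x = g x.
Proof.
by move=> oU Ux fg; apply: filterS fg _; exact: open_nbhs_nbhs.
Qed.

Section ck.
Context {R : realType} {V W : normedModType R}.
Implicit Types (f g : V -> W) (U : set V).

Lemma Ck_on_continuous k U f : Ck_on k U f -> forall x, U x -> {for x, continuous f}.
Proof. by case: k => [|k] []. Qed.

Lemma Ck_on_derivable k U f v : Ck_on k.+1 U f ->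
  forall x, U x -> derivable f x v.
Proof. by move=> [_ /(_ v)[]]. Qed.

Lemma Ck_on_derive k U f v : Ck_on k.+1 U f -> Ck_on k U (fun x => 'D_v f x).
Proof. by move=> [_ /(_ v)[]]. Qed.

Lemma smooth_on_derivable U f v : smooth_on U f -> forall x, U x -> derivable f x v.
Proof. by move=> /(_ 1%N); exact: Ck_on_derivable. Qed.

Lemma smooth_on_derive U f v : smooth_on U f -> smooth_on U (fun x => 'D_v f x).
Proof. by move=> fs k; exact: Ck_on_derive. Qed.

Lemma Ck_on_ext k U f g : open U -> (forall y, U y -> f y = g y) ->
  Ck_on k U f -> Ck_on k U g.
Proof.
move=> oU; elim: k f g => [|k IH] f g fg [fc fd].
  split=> // x Ux; rewrite /prop_for /continuous_at -fg//.
  have /near_eq_cvg fgx := open_eq_near oU Ux fg.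
  by apply: cvg_trans (fc x Ux); exact: fgx.
split=> [x Ux|v].
  rewrite /prop_for /continuous_at -fg//.
  have /near_eq_cvg fgx := open_eq_near oU Ux fg.
  by apply: cvg_trans (fc x Ux); exact: fgx.
have [fd1 fd2] := fd v; split=> [x Ux|].
  exact: near_eq_derivable (open_eq_near oU Ux fg) (fd1 x Ux).
apply: IH fd2 => y Uy; exact/near_eq_derive/(open_eq_near oU Uy fg).
Qed.

Lemma smooth_on_ext U f g : open U -> (forall y, U y -> f y = g y) ->
  smooth_on U f -> smooth_on U g.
Proof. by move=> oU fg fs k; apply: Ck_on_ext (fs k). Qed.

Lemma Ck_on_cst k U (a : W) : Ck_on k U (cst a : V -> W).
Proof.
elim: k a => [|k IH] a; (split=> [x _|]; first exact: cst_continuous) => //.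
move=> v; split=> [x _|]; first exact: derivable_cst.
have -> : (fun x : V => 'D_v (cst a : V -> W) x) = cst 0.
  by apply/funext => x; rewrite derive_cst.
exact: IH.
Qed.

Lemma smooth_on_cst U (a : W) : smooth_on U (cst a : V -> W).
Proof. by move=> k; exact: Ck_on_cst. Qed.

Lemma Ck_on_add k U f g : open U ->
  Ck_on k U f -> Ck_on k U g -> Ck_on k U (fun x => f x + g x).
Proof.
move=> oU; elim: k f g => [|k IH] f g [fc fd] [gc gd].
  by split=> // x Ux; apply: cvgD; [exact: fc | exact: gc].
split=> [x Ux|v]; first by apply: cvgD; [exact: fc | exact: gc].
have [fd1 fd2] := fd v; have [gd1 gd2] := gd v; split=> [x Ux|].
  by apply: derivableD; [exact: fd1 | exact: gd1].
apply: Ck_on_ext oU _ (IH _ _ fd2 gd2) => y Uy /=.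
by rewrite -deriveD; [ | exact: fd1 | exact: gd1].
Qed.

Lemma smooth_on_add U f g : open U ->
  smooth_on U f -> smooth_on U g -> smooth_on U (fun x => f x + g x).
Proof. by move=> oU fs gs k; exact: Ck_on_add. Qed.

Lemma smooth_on_sum (I : Type) (r : seq I) (F : I -> V -> W) U : open U ->
  (forall i, smooth_on U (F i)) -> smooth_on U (fun x => \sum_(i <- r) F i x).
Proof.
move=> oU Fs; elim: r => [|i r IH].
  under eq_fun do rewrite big_nil; exact: smooth_on_cst.
under eq_fun do rewrite big_cons; exact: smooth_on_add.
Qed.

End ck.
Arguments Ck_on_continuous {R V W k U f} _ {x} _.
Arguments Ck_on_derivable {R V W k U f v} _ {x} _.
Arguments smooth_on_derivable {R V W U f v} _ {x} _.


Section ckmul.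
Context {R : realType} {V : normedModType R}.
Implicit Types (f g : V -> R) (U : set V).

Lemma Ck_on_W k U f : Ck_on k.+1 U f -> Ck_on k U f.
Proof.
elim: k f => [|k IH] f [fc fd]; first by split.
by split=> // v; have [fd1 fd2] := fd v; split=> //; exact: IH.
Qed.

Lemma Ck_on_mul k U f g : open U ->
  Ck_on k U f -> Ck_on k U g -> Ck_on k U (fun x => f x * g x).
Proof.
move=> oU; elim: k f g => [|k IH] f g fk gk.
  have [fc _] := fk; have [gc _] := gk.
  by split=> // x Ux; apply: cvgM; [exact: fc | exact: gc].
have [fc fd] := fk; have [gc gd] := gk.
split=> [x Ux|v]; first by apply: cvgM; [exact: fc | exact: gc].
have [fd1 fd2] := fd v; have [gd1 gd2] := gd v; split=> [x Ux|].
  by apply: derivableM; [exact: fd1 | exact: gd1].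
have H1 := IH _ _ (Ck_on_W fk) gd2.
have H2 := IH _ _ (Ck_on_W gk) fd2.
apply: Ck_on_ext oU _ (Ck_on_add oU H1 H2) => y Uy /=.
by rewrite -[RHS]/('D_v (f * g) y) deriveM; [ | exact: fd1 | exact: gd1].
Qed.

Lemma smooth_on_mul U f g : open U ->
  smooth_on U f -> smooth_on U g -> smooth_on U (fun x => f x * g x).
Proof. by move=> oU fs gs k; exact: Ck_on_mul. Qed.

End ckmul.

Section ckmx.
Context {R : realType} {V : normedModType R} {m n : nat}.

Lemma smooth_on_coord (U : set V) (f : V -> 'M[R]_(m, n)) i j : open U ->
  smooth_on U f -> smooth_on U (fun x => f x i j).
Proof.
move=> oU fs k; elim: k f {fs}(fs k) => [|k IH] f [fc fd].
  split=> // x Ux; apply: (@continuous_comp _ _ _ f (fun M : 'M[R]_(m, n) => M i j)); first exact: fc.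
  exact: coord_continuous.
split=> [x Ux|v].
  apply: (@continuous_comp _ _ _ f (fun M : 'M[R]_(m, n) => M i j)); first exact: fc.
  exact: coord_continuous.
have [fd1 fd2] := fd v; split=> [x Ux|].
  by have /derivable_mxP := fd1 x Ux; apply.
apply: Ck_on_ext oU _ (IH _ fd2) => y Uy /=.
by rewrite derive_mx ?mxE //; exact: fd1.
Qed.

End ckmx.

(** * Symmetry of second derivatives and differentiability of C^1 functions *)

Section schwarz.
Context {R : realType} {V : normedModType R}.

(** Two applications of the mean value theorem, first to
    y |-> f (s v + y) - f y along u, then to 'D_u f along v. *)
Lemma second_difference (f : V -> R) (x u v : V) (s : R) :
  (forall a b, `|a| <= `|s| -> `|b| <= `|s| ->
     derivable f (a *: u + (b *: v + x)) u /\
     derivable (fun y => 'D_u f y) (b *: v + (a *: u + x)) v) ->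
  exists a b, [/\ `|a| <= `|s|, `|b| <= `|s| &
    f (s *: u + (s *: v + x)) - f (s *: u + x) - f (s *: v + x) + f x
    = s * (s * 'D_v (fun y => 'D_u f y) (b *: v + (a *: u + x)))].
Proof.
move=> H.
have s0 : `|0 : R| <= `|s| by rewrite normr0.
pose g y := f (s *: v + y) - f y.
have shift_der t w : derivable f (w + t) u -> is_derive t u (fun y => f (w + y)) ('D_u f (w + t)).
  have E : (fun h : R => h^-1 *: (f (w + (h *: u + t)) - f (w + t)))
    = (fun h : R => h^-1 *: (f (h *: u + (w + t)) - f (w + t))).
    by apply/funext => h; rewrite addrCA.
  move=> d; split; first by rewrite /derivable /= E.
  by rewrite /derive /= E.
have gder a : `|a| <= `|s| -> is_derive (a *: u + x) u g
    ('D_u f (s *: v + (a *: u + x)) - 'D_u f (a *: u + x)).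
  move=> aI; apply: is_deriveB.
    by apply: shift_der; rewrite addrCA; exact: (H a s aI _).1.
  by apply/derivableP; have := (H a 0 aI s0).1; rewrite scale0r add0r.
have [a aI E1] := mvt_line (f := g) (x := x) (v := u) (s := s) (fun t ht => @ex_derive _ _ _ _ _ _ _ (gder t ht)).
have [b bI E2] := mvt_line (f := fun y => 'D_u f y) (x := a *: u + x) (v := v) (s := s)
  (fun t ht => (H a t aI ht).2).
exists a, b; split=> //; rewrite -E2 -(@derive_val _ _ _ _ _ _ _ (gder a aI)) -E1 /g.
rewrite [s *: v + (s *: u + x)]addrCA; ring.
Qed.

(** The second difference does not change when u and v are exchanged, so both
    mixed derivatives take the same value at points arbitrarily close to x. *)
Lemma schwarz (U : set V) (f : V -> R) (x u v : V) : open U -> Ck_on 2 U f -> U x ->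
  'D_u (fun y => 'D_v f y) x = 'D_v (fun y => 'D_u f y) x.
Proof.
move=> oU f2 Ux.
apply/eqP; rewrite -subr_eq0 -normr_le0; apply/ler_addgt0Pr => e e0; rewrite add0r.
have e20 : 0 < e / 2 by rewrite divr_gt0.
have c1 := Ck_on_continuous (Ck_on_derive u (Ck_on_derive v f2)) Ux.
have c2 := Ck_on_continuous (Ck_on_derive v (Ck_on_derive u f2)) Ux.
have /nbhs_normP[d /= d0 Hd] : nbhs x (fun y => U y /\
   (`|'D_u (fun y => 'D_v f y) x - 'D_u (fun y => 'D_v f y) y| < e / 2 /\
   `|'D_v (fun y => 'D_u f y) x - 'D_v (fun y => 'D_u f y) y| < e / 2)).
  apply: filterI; first exact: open_nbhs_nbhs.
  move: c1 c2 => /cvgrPdist_lt/(_ _ e20) c1 /cvgrPdist_lt/(_ _ e20) c2.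
  exact: filterI c1 c2.
(* With this step all the points met below are at distance less than d from x. *)
pose s := d / (`|u| + `|v| + 1).
have n0 : 0 < `|u| + `|v| + 1 by rewrite ltr_wpDl ?addr_ge0.
have s0 : 0 < s by rewrite divr_gt0.
have near_pt a b : `|a| <= `|s| -> `|b| <= `|s| -> ball_ Num.norm x d (a *: u + (b *: v + x)).
  move=> ha hb; rewrite /ball_ /= addrA opprD addrCA subrr addr0 normrN.
  apply: le_lt_trans (ler_normD _ _) _; rewrite !normrZ.
  apply: (@le_lt_trans _ _ (s * (`|u| + `|v|))).
    rewrite (gtr0_norm s0) in ha hb; by rewrite mulrDr lerD // ler_wpM2r.
  rewrite /s mulrAC ltr_pdivrMr // ltr_pM2l //; lra.
have near_pt' a b : `|a| <= `|s| -> `|b| <= `|s| -> ball_ Num.norm x d (a *: v + (b *: u + x)).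
  by move=> ha hb; rewrite addrCA; exact: near_pt.
have [a [b [ha hb E1]]] : exists a b, [/\ `|a| <= `|s|, `|b| <= `|s| &
    f (s *: u + (s *: v + x)) - f (s *: u + x) - f (s *: v + x) + f x
    = s * (s * 'D_v (fun y => 'D_u f y) (b *: v + (a *: u + x)))].
  apply: second_difference => a b ha hb; split.
    exact (Ck_on_derivable f2 (Hd _ (near_pt _ _ ha hb)).1).
  exact (Ck_on_derivable (Ck_on_derive u f2) (Hd _ (near_pt' _ _ hb ha)).1).
have [a' [b' [ha' hb' E2]]] : exists a b, [/\ `|a| <= `|s|, `|b| <= `|s| &
    f (s *: v + (s *: u + x)) - f (s *: v + x) - f (s *: u + x) + f x
    = s * (s * 'D_u (fun y => 'D_v f y) (b *: u + (a *: v + x)))].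
  apply: second_difference => a' b' ha' hb'; split.
    exact (Ck_on_derivable f2 (Hd _ (near_pt' _ _ ha' hb')).1).
  exact (Ck_on_derivable (Ck_on_derive v f2) (Hd _ (near_pt _ _ hb' ha')).1).
have {E1 E2} E : 'D_u (fun y => 'D_v f y) (b' *: u + (a' *: v + x)) =
    'D_v (fun y => 'D_u f y) (b *: v + (a *: u + x)).
  have sn0 := lt0r_neq0 s0.
  have C : f (s *: v + (s *: u + x)) - f (s *: v + x) - f (s *: u + x) + f x =
      f (s *: u + (s *: v + x)) - f (s *: u + x) - f (s *: v + x) + f x.
    by rewrite [s *: v + (s *: u + x)]addrCA; congr (_ + _); rewrite addrAC.
  apply: (mulfI sn0); apply: (mulfI sn0).
  exact: (etrans (esym E2) (etrans C E1)).
have [_ [h1 _]] := Hd _ (near_pt _ _ hb' ha').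
have [_ [_ h2]] := Hd _ (near_pt' _ _ hb ha).
rewrite E in h1; rewrite [e]splitr.
apply: le_trans (ler_distD ('D_v (fun y => 'D_u f y) (b *: v + (a *: u + x))) _ _) _.
apply: lerD. exact: (ltW h1). rewrite distrC. exact: (ltW h2).
Qed.

End schwarz.

Section c1diff.
Context {R : realType} {n : nat}.
Local Notation V := 'rV[R]_n.

Definition linform (w : 'I_n -> R) (h : V) : R := \sum_i h 0 i * w i.

Lemma linform_is_linear w : linear (linform w).
Proof.
move=> a h k; rewrite /linform scaler_sumr -big_split /=; apply: eq_bigr => i _.
by rewrite !mxE mulrDl -mulrA.
Qed.
HB.instance Definition _ w := GRing.isLinear.Build R V R *:%R (linform w) (linform_is_linear w).

Lemma linform_continuous w : continuous (linform w).
Proof.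
apply: continuous_big => [|i _ x]; first exact: add_continuous.
apply: (@continuousM _ _ (fun y : V => y 0 i) (cst (w i)) x).
  exact: coord_continuous.
exact: cst_continuous.
Qed.

Lemma row_norm_le (h k : V) : (forall i, `|h 0 i| <= `|k 0 i|) -> `|h| <= `|k|.
Proof.
move=> H; rewrite [leLHS]/Num.Def.normr /= mx_normrE; apply: bigmax_le => //.
move=> [i j] _ /=; rewrite ord1; apply: le_trans (H j) _.
rewrite [leRHS]/Num.Def.normr /= mx_normrE; exact: (le_bigmax _ _ (ord0, j)).
Qed.

Lemma row_coord_le (h : V) i : `|h 0 i| <= `|h|.
Proof.
by rewrite [leRHS]/Num.Def.normr /= mx_normrE; exact: (le_bigmax _ _ (ord0, i)).
Qed.

(** Going from x to x + h one coordinate at a time, the mean value theorem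
    expresses each increment by a partial derivative at a point close to x, and
    continuity of the partial derivatives bounds the error by a small multiple
    of the norm of h. *)
Lemma C1_differentiable (U : set V) (f : V -> R) x : open U -> Ck_on 1 U f -> U x ->
  differentiable f x.
Proof.
move=> oU f1 Ux.
pose e_ i : V := delta_mx 0 i.
pose D i y := 'D_(e_ i) f y.
pose L : {linear V -> R} := linform (fun i => D i x).
have Lc : continuous L by exact: linform_continuous.
suff H : f \o shift x = cst (f x) + (L : V -> R) +o_ (0 : V) id.
  apply/diff_locallyP; rewrite (diff_unique Lc H); split=> //.
apply/eqaddoP => _/posnumP[e].
have e'0 : 0 < e%:num / n.+1%:R by rewrite divr_gt0.
have /nbhs_normP[d /= d0 Hd] : nbhs x (fun y => U y /\
    forall i, `|D i x - D i y| < e%:num / n.+1%:R).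
  apply: filterI; first exact: open_nbhs_nbhs.
  apply: (filter_forall (F := nbhs x) (f := fun i y => `|D i x - D i y| < e%:num / n.+1%:R)) => i.
  have := Ck_on_continuous (Ck_on_derive (e_ i) f1) Ux.
  by move/cvgrPdist_lt => /(_ _ e'0).
near=> h; have hd : `|h| < d by near: h; exact: cvgr0_norm_lt.
(* The corners of the path from 0 to h along the coordinate axes. *)
pose tr (k : nat) : V := \row_i (if (i < k)%N then h 0 i else 0).
have trS (i : 'I_n) : tr i.+1 = h 0 i *: e_ i + tr i.
  apply/rowP => j; rewrite !mxE eqxx /= ltnS -val_eqE /=.
  by case: ltngtP => ji; rewrite ?mulr1 ?mulr0 ?addr0 ?add0r ?(val_inj ji).
have trn : tr n = h by apply/rowP => j; rewrite !mxE ltn_ord.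
have tr0 : tr 0%N = 0 by apply/rowP => j; rewrite !mxE.
have pt (i : 'I_n) t : `|t| <= `|h 0 i| -> ball_ Num.norm x d (t *: e_ i + (tr i + x)).
  move=> ti; rewrite /ball_ /= addrA opprD addrCA subrr addr0 normrN.
  apply: le_lt_trans hd; apply: row_norm_le => j; rewrite !mxE eqxx /= -val_eqE.
  by case: ltngtP => ji; rewrite ?mulr1 ?mulr0 ?addr0 ?add0r ?normr0 ?(val_inj ji).
have step (i : 'I_n) : `|f (tr i.+1 + x) - f (tr i + x) - h 0 i * D i x| <= e%:num / n.+1%:R * `|h|.
  have [t ti E] := mvt_line (f := f) (x := tr i + x) (v := e_ i) (s := h 0 i)
    (fun t ti => Ck_on_derivable f1 (Hd _ (pt i t ti)).1).
  rewrite trS -[_ *: _ + _ + x]addrA E -mulrBr normrM mulrC ler_pM //; last exact: row_coord_le.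
  by rewrite distrC ltW //; exact: (Hd _ (pt i t ti)).2.
have -> : (f \o shift x - (cst (f x) + L)) h =
    \sum_(i < n) (f (tr i.+1 + x) - f (tr i + x) - h 0 i * D i x).
  rewrite sumrB -(big_mkord xpredT (fun i => f (tr i.+1 + x) - f (tr i + x))) telescope_sumr //.
  by rewrite trn tr0 add0r opprD addrA.
apply: le_trans (ler_norm_sum _ _ _) _.
apply: le_trans (ler_sum _ (fun i _ => step i)) _.
rewrite sumr_const card_ord -[_ *+ n]mulr_natl mulrA ler_wpM2r //.
rewrite mulrCA -[leRHS]mulr1 ler_pM2l // ler_pdivrMr // mul1r ler_nat //.
Unshelve. all: by end_near. Qed.

Lemma C1_derive_linear (U : set V) (f : V -> R) x a u v : open U -> Ck_on 1 U f -> U x ->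
  'D_(a *: u + v) f x = a * 'D_u f x + 'D_v f x.
Proof.
move=> oU f1 Ux; have df := C1_differentiable oU f1 Ux.
by rewrite !deriveE // linearP.
Qed.

Lemma C1_chain (U : set V) (f : V -> R) (c : R -> V) (s : R) :
  open U -> Ck_on 1 U f -> U (c s) -> derivable c s 1 ->
  is_derive s 1 (fun t => f (c t)) ('D_(derive1 c s) f (c s)).
Proof.
move=> oU f1 Uc dc.
have df := C1_differentiable oU f1 Uc.
have {}dc : differentiable c s by exact/derivable1_diffP.
have dfc : differentiable (f \o c) s by exact: differentiable_comp.
split; first exact/derivable1_diffP.
rewrite -[LHS]/('D_1 (f \o c) s) deriveE // diff_comp //= derive1E' // deriveE //.
Qed.
End c1diff.

(** * Algebra of a naturally reductive decomposition *)

Section dot.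
Context {R : realType} {N : nat}.
Local Notation g := 'rV[R]_N.
Definition dot (x y : g) : R := \sum_i x 0 i * y 0 i.

Lemma dotC x y : dot x y = dot y x.
Proof. by apply: eq_bigr => i _; rewrite mulrC. Qed.

Lemma dot_linl a x y z : dot (a *: x + y) z = a * dot x z + dot y z.
Proof.
rewrite /dot mulr_sumr -big_split /=; apply: eq_bigr => i _.
by rewrite !mxE mulrDl mulrA.
Qed.

Lemma dotDl x y z : dot (x + y) z = dot x z + dot y z.
Proof. by have := dot_linl 1 x y z; rewrite scale1r mul1r. Qed.

Lemma dotZl a x z : dot (a *: x) z = a * dot x z.
Proof.
have -> : a *: x = a *: x + 0 by rewrite addr0.
rewrite dot_linl [dot 0 z]big1 ?addr0 // => i _; by rewrite mxE mul0r.
Qed.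

Lemma dotNl x z : dot (- x) z = - dot x z.
Proof. by rewrite -scaleN1r dotZl mulN1r. Qed.

Lemma dotDr x y z : dot x (y + z) = dot x y + dot x z.
Proof. by rewrite !(dotC x) dotDl. Qed.

Lemma dotZr a x z : dot x (a *: z) = a * dot x z.
Proof. by rewrite !(dotC x) dotZl. Qed.

Lemma dotNr x z : dot x (- z) = - dot x z.
Proof. by rewrite !(dotC x) dotNl. Qed.

Lemma dot_eq0 x : dot x x = 0 -> x = 0.
Proof.
move=> /eqP; rewrite psumr_eq0 => [/allP H|i _]; last by rewrite -expr2 sqr_ge0.
apply/rowP => i; rewrite mxE; apply/eqP.
by have := H i (mem_index_enum i); rewrite /= mulf_eq0 orbb.
Qed.
End dot.

Section reductive.
Context {R : realType} {N : nat}.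
Local Notation g := 'rV[R]_N.

(** A Lie algebra with an ad-invariant scalar product, the orthogonal projection
    pm onto a subspace m, and its kernel h a subalgebra (br_hh): the infinitesimal
    form of a normal homogeneous space. *)
Record naturally_reductive (br : g -> g -> g) (pm : g -> g) : Prop := NaturallyReductive {
  br_linl : forall a x y z, br (a *: x + y) z = a *: br x z + br y z;
  br_anti : forall x y, br x y = - br y x;
  br_jacobi : forall x y z, br (br x y) z = br x (br y z) - br y (br x z);
  br_dot : forall x y z, dot (br x y) z = dot x (br y z);
  pm_lin : forall a x y, pm (a *: x + y) = a *: pm x + pm y;
  pm_idem : forall x, pm (pm x) = pm x;
  pm_dot : forall x y, dot (pm x) y = dot x (pm y);
  br_hh : forall x y, pm (br (x - pm x) (y - pm y)) = 0 }.

Variables (br : g -> g -> g) (pm : g -> g).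
Hypothesis nr : naturally_reductive br pm.

Lemma brDl x y z : br (x + y) z = br x z + br y z.
Proof. by have := br_linl nr 1 x y z; rewrite !scale1r. Qed.
Lemma br0l z : br 0 z = 0.
Proof. by apply: (addrI (br 0 z)); rewrite -brDl !addr0. Qed.
Lemma brZl a x z : br (a *: x) z = a *: br x z.
Proof. by have := br_linl nr a x 0 z; rewrite br0l !addr0. Qed.
Lemma brNl x z : br (- x) z = - br x z.
Proof. by rewrite -scaleN1r brZl scaleN1r. Qed.
Lemma brDr x y z : br x (y + z) = br x y + br x z.
Proof. by rewrite !(br_anti nr x) brDl opprD. Qed.
Lemma brZr a x z : br x (a *: z) = a *: br x z.
Proof. by rewrite !(br_anti nr x) brZl scalerN. Qed.
Lemma brNr x z : br x (- z) = - br x z.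
Proof. by rewrite -scaleN1r brZr scaleN1r. Qed.
Lemma br0r z : br z 0 = 0.
Proof. by rewrite (br_anti nr) br0l oppr0. Qed.
Lemma brxx x : br x x = 0.
Proof.
apply/rowP => k; have /rowP/(_ k) := br_anti nr x x; rewrite !mxE; lra.
Qed.
Lemma pmD x y : pm (x + y) = pm x + pm y.
Proof. by have := pm_lin nr 1 x y; rewrite !scale1r. Qed.
Lemma pm0 : pm 0 = 0.
Proof. by apply: (addrI (pm 0)); rewrite -pmD !addr0. Qed.
Lemma pmZ a x : pm (a *: x) = a *: pm x.
Proof. by have := pm_lin nr a x 0; rewrite pm0 !addr0. Qed.
Lemma pmN x : pm (- x) = - pm x.
Proof. by rewrite -scaleN1r pmZ scaleN1r. Qed.

Definition ph (x : g) : g := x - pm x.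

Lemma ph_dot x y : dot (ph x) y = dot x (ph y).
Proof. by rewrite /ph dotDl dotDr dotNl dotNr (pm_dot nr). Qed.

(** By invariance [h, m] is orthogonal to h, because [h, h] is contained in h. *)
Lemma br_hm x y : pm (br (ph x) (pm y)) = br (ph x) (pm y).
Proof.
apply: esym; suff : ph (br (ph x) (pm y)) = 0 by move/eqP; rewrite subr_eq0 => /eqP.
apply: dot_eq0; rewrite ph_dot; set w := ph _.
rewrite (br_anti nr) dotNl (br_dot nr) (pm_dot nr) [pm _](br_hh nr).
by rewrite dotC /dot big1 ?oppr0 // => i _; rewrite mxE mul0r.
Qed.

Lemma br_h_pm x y : br (ph x) (pm y) = pm (br (ph x) y).
Proof.
rewrite -br_hm -[in RHS](subrK (pm y) y) brDr pmD.
by rewrite [X in X + _](br_hh nr) add0r.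
Qed.

(** The m-component of the bracket; on V_1 it is the cross product of R^7. *)
Definition mb (x y : g) : g := pm (br x y).

(** Connection form of the Levi-Civita connection in the frame given by the
    m-component of the Maurer-Cartan form, as a function of the value X of that
    form on the direction of differentiation. *)
Definition Lam (X Z : g) : g := br (ph X) Z + 2^-1 *: mb (pm X) Z.

(** Curvature of a normal homogeneous space at the origin. *)
Definition curv (x y z : g) : g :=
  4^-1 *: (mb x (mb y z) - mb y (mb x z)) - br (ph (br x y)) z - 2^-1 *: mb (mb x y) z.

(** Cartan's formula d Lam + [Lam, Lam] for the curvature, with d omega replaced
    by - [omega, omega]: by the Jacobi identity and the h-equivariance of pm all
    the terms that contain an h-component cancel. *)
Lemma Lam_frame_curv X Y Z :
  Lam (- br X Y) Z + Lam X (Lam Y Z) - Lam Y (Lam X Z) = curv (pm X) (pm Y) Z.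
Proof.
have hX : X = ph X + pm X by rewrite subrK.
have hY : Y = ph Y + pm Y by rewrite subrK.
have E0 : br X Y = br (ph X) (ph Y) + br (ph X) (pm Y) + br (pm X) (ph Y) + br (pm X) (pm Y).
  by rewrite {1}hX {1}hY brDl !brDr !addrA.
have hma x y : pm (br (pm x) (ph y)) = br (pm x) (ph y).
  by rewrite (br_anti nr) pmN br_hm.
have Epm : pm (br X Y) = br (ph X) (pm Y) + br (pm X) (ph Y) + pm (br (pm X) (pm Y)).
  by rewrite E0 !pmD (br_hh nr) add0r br_hm hma.
have Eph : ph (br X Y) = br (ph X) (ph Y) + ph (br (pm X) (pm Y)).
  by rewrite {1}/ph Epm E0 /ph; apply/rowP => k; rewrite !mxE; ring.
rewrite /Lam /curv /mb.
have -> : ph (- br X Y) = - ph (br X Y) by rewrite /ph pmN opprD.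
rewrite pmN Epm Eph.
have -> : ph (br (pm X) (pm Y)) = br (pm X) (pm Y) - pm (br (pm X) (pm Y)) by [].
move: (br_h_pm X) (br_h_pm Y) {hX hY E0 hma Epm Eph}.
move: (ph X) (ph Y) (pm X) (pm Y) => a b x y ea eb.
rewrite !(brDr, brZr, brNl, brNr, brDl) !(ea, eb) !(pmD, pmZ, pmN).
rewrite !(br_jacobi nr a) !(br_jacobi nr x b).
rewrite !(pmD, pmZ, pmN).
by apply/rowP => k; rewrite !mxE; field.
Qed.

Lemma mbDl x y z : mb (x + y) z = mb x z + mb y z.
Proof. by rewrite /mb brDl pmD. Qed.
Lemma mbDr x y z : mb x (y + z) = mb x y + mb x z.
Proof. by rewrite /mb brDr pmD. Qed.
Lemma mbZl a x z : mb (a *: x) z = a *: mb x z.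
Proof. by rewrite /mb brZl pmZ. Qed.
Lemma mbZr a x z : mb x (a *: z) = a *: mb x z.
Proof. by rewrite /mb brZr pmZ. Qed.
Lemma mbNr x z : mb x (- z) = - mb x z.
Proof. by rewrite /mb brNr pmN. Qed.
Lemma mbxx x : mb x x = 0.
Proof. by rewrite /mb brxx pm0. Qed.
Lemma mb0r x : mb x 0 = 0.
Proof. by rewrite /mb br0r pm0. Qed.
Lemma mb0l x : mb 0 x = 0.
Proof. by rewrite /mb br0l pm0. Qed.
Lemma phD x y : ph (x + y) = ph x + ph y.
Proof. by rewrite /ph pmD opprD addrACA. Qed.
Lemma phZ a x : ph (a *: x) = a *: ph x.
Proof. by rewrite /ph pmZ scalerBr. Qed.

Ltac vec := by apply/rowP => ?; rewrite !mxE; field.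

Lemma curv_lin1 k x x' y z : curv (k *: x + x') y z = k *: curv x y z + curv x' y z.
Proof.
rewrite /curv (brDl _ _ y) (brZl _ _ y) phD phZ (brDl _ _ z) (brZl _ _ z).
rewrite !(mbDl, mbZl, mbDr, mbZr); vec.
Qed.
Lemma curv_lin2 k x y y' z : curv x (k *: y + y') z = k *: curv x y z + curv x y' z.
Proof.
rewrite /curv (brDr x) (brZr _ x) phD phZ (brDl _ _ z) (brZl _ _ z).
rewrite !(mbDl, mbZl, mbDr, mbZr); vec.
Qed.
Lemma curv_lin3 k x y z z' : curv x y (k *: z + z') = k *: curv x y z + curv x y z'.
Proof.
rewrite /curv (brDr (ph _)) (brZr _ (ph _)) !(mbDr, mbZr); vec.
Qed.


Lemma Lam_linl k X X' Z : Lam (k *: X + X') Z = k *: Lam X Z + Lam X' Z.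
Proof.
rewrite /Lam phD phZ (brDl (_ *: _)) (brZl _ (ph _)) pmD pmZ mbDl mbZl; vec.
Qed.
Lemma Lam_linr k X Z Z' : Lam X (k *: Z + Z') = k *: Lam X Z + Lam X Z'.
Proof.
by rewrite /Lam (brDr (ph _)) (brZr _ (ph _)) !(mbDr, mbZr); vec.
Qed.

Lemma pm_Lam X Z : pm Z = Z -> pm (Lam X Z) = Lam X Z.
Proof.
by move=> mZ; rewrite /Lam pmD pmZ [pm (mb _ _)](pm_idem nr) -{1}mZ br_hm mZ.
Qed.

(** Together with the Maurer-Cartan equation this is the vanishing of the
    torsion of the connection with form Lam. *)
Lemma Lam_torsion X Y : Lam X (pm Y) - Lam Y (pm X) = pm (br X Y).
Proof.
have hX : X = ph X + pm X by rewrite subrK.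
have hY : Y = ph Y + pm Y by rewrite subrK.
have E0 : br X Y = br (ph X) (ph Y) + br (ph X) (pm Y) - br (ph Y) (pm X) + br (pm X) (pm Y).
  by rewrite {1}hX {1}hY brDl (brDr (ph X)) (brDr (pm X)) (br_anti nr (pm X) (ph Y)) !addrA.
rewrite E0 pmD pmD pmN pmD (br_hh nr) add0r !br_hm /Lam /mb (br_anti nr (pm Y) (pm X)) pmN; vec.
Qed.

Lemma Lam_skew X y z : pm y = y -> pm z = z -> dot (Lam X y) z + dot y (Lam X z) = 0.
Proof.
move=> my mz; rewrite /Lam /mb !(dotDl, dotDr, dotZl, dotZr) (pm_dot nr) mz -(pm_dot nr y) my.
rewrite !(br_anti nr _ y) !dotNl !(br_dot nr); ring.
Qed.

(** The derivation 1/2 [a, .]_m of trilinear maps, applied i times to the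
    curvature: the i-th covariant derivative of the curvature along a geodesic of
    velocity a, see jet_frame. *)
Fixpoint cjet (i : nat) (a x y z : g) : g :=
  if i is j.+1 then
    2^-1 *: (mb a (cjet j a x y z) - cjet j a (mb a x) y z
             - cjet j a x (mb a y) z - cjet j a x y (mb a z))
  else curv x y z.

Lemma cjet_lin1 i a k x x' y z :
  cjet i a (k *: x + x') y z = k *: cjet i a x y z + cjet i a x' y z.
Proof.
elim: i x x' y z => [|i IH] x x' y z /=; first exact: curv_lin1.
by rewrite !(mbDr, mbZr, IH); vec.
Qed.
Lemma cjet_lin2 i a k x y y' z :
  cjet i a x (k *: y + y') z = k *: cjet i a x y z + cjet i a x y' z.
Proof.
elim: i x y y' z => [|i IH] x y y' z /=; first exact: curv_lin2.
by rewrite !(mbDr, mbZr, IH); vec.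
Qed.
Lemma cjet_lin3 i a k x y z z' :
  cjet i a x y (k *: z + z') = k *: cjet i a x y z + cjet i a x y z'.
Proof.
elim: i x y z z' => [|i IH] x y z z' /=; first exact: curv_lin3.
by rewrite !(mbDr, mbZr, IH); vec.
Qed.
Lemma cjet02 i a x z : cjet i a x 0 z = 0.
Proof.
by have := cjet_lin2 i a 1 x 0 0 z; rewrite !scale1r addr0 -{1}[cjet _ _ _ _ _]addr0 => /addrI.
Qed.
Lemma cjet03 i a x y : cjet i a x y 0 = 0.
Proof.
by have := cjet_lin3 i a 1 x y 0 0; rewrite !scale1r addr0 -{1}[cjet _ _ _ _ _]addr0 => /addrI.
Qed.

(** The i-th covariant derivative of the Jacobi operator, read in the frame. *)
Definition jac i a x := cjet i a x a a.

Lemma jac_lin i a k x x' : jac i a (k *: x + x') = k *: jac i a x + jac i a x'.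
Proof. exact: cjet_lin1. Qed.

(** The two inner slots contribute nothing because [a, a]_m = 0. *)
Lemma jacS i a x : jac i.+1 a x = 2^-1 *: (mb a (jac i a x) - jac i a (mb a x)).
Proof. by rewrite /jac /= mbxx cjet02 cjet03 !subr0. Qed.

Hypothesis cross : forall a x, pm a = a -> pm x = x ->
  mb a (mb a x) = dot a x *: a - dot a a *: x.

Lemma pm_mb x y : pm (mb x y) = mb x y.
Proof. exact: (pm_idem nr). Qed.

(** Expand ad_L^3 J_0 for L = 1/2 [a, .]_m: as L^2 is - 1/4 on the orthogonal
    complement of a, where J_0 takes its values, and J_0 a = 0, the four terms
    combine to - ad_L J_0. *)
Lemma jac3 a x : pm a = a -> pm x = x -> dot a a = 1 -> jac 3 a x = - jac 1 a x.
Proof.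
move=> ma mx a1.
have jD y y' : jac 0 a (y + y') = jac 0 a y + jac 0 a y'.
  by have := jac_lin 0 a 1 y y'; rewrite !scale1r.
have j0 : jac 0 a 0 = 0 by apply: (addrI (jac 0 a 0)); rewrite -jD !addr0.
have jZ k y : jac 0 a (k *: y) = k *: jac 0 a y.
  by have := jac_lin 0 a k y 0; rewrite j0 !addr0.
have jN y : jac 0 a (- y) = - jac 0 a y by rewrite -scaleN1r jZ scaleN1r.
have ja : jac 0 a a = 0.
  have ph0 : ph 0 = 0 by rewrite /ph pm0 subr0.
  by rewrite /jac /= /curv mbxx mb0r brxx ph0 mb0l br0l !(subrr, subr0, scaler0).
have mj y : pm y = y -> pm (jac 0 a y) = jac 0 a y.
  move=> my; rewrite /jac /= /curv !(pmD, pmN, pmZ, pm_mb); congr (_ - _ - _).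
  by rewrite -[in X in _ = X]ma -br_hm ma.
have dj y : dot a (jac 0 a y) = 0.
  have dmb w w' : dot a (mb w w') = dot a (br w w') by rewrite /mb -(pm_dot nr) ma.
  rewrite /jac /= /curv mbxx mb0r sub0r !(dotDr, dotNr, dotZr, dmb).
  have da w : dot a (br w a) = 0.
    by rewrite dotC (br_dot nr) brxx /dot big1 // => i _; rewrite mxE mulr0.
  have da' w : dot a (br a w) = 0 by rewrite (br_anti nr) dotNr da oppr0.
  by rewrite da' !da; ring.
have LL y : pm y = y -> mb a (mb a y) = dot a y *: a - y.
  by move=> my; rewrite cross // a1 scale1r.
rewrite !jacS; move: (jac 0 a) jD j0 jN jZ ja mj dj => j jD j0 jN jZ ja mj dj.
rewrite !(mbDr, mbZr, mbNr) (LL (j x)) ?mj // dj scale0r sub0r.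
rewrite !(LL (j (mb a x))) ?mj ?pm_mb // dj scale0r sub0r.
rewrite !(LL x) // !(jD, j0, jN, jZ, ja, mbDr, mbZr, mbNr, mb0r, mbxx) !scaler0.
vec.
Qed.

Lemma jac_period i a x : pm a = a -> pm x = x -> dot a a = 1 ->
  jac i.+3 a x = - jac i.+1 a x.
Proof.
move=> ma + a1; elim: i x => [|i IH] x mx; first exact: jac3.
rewrite jacS !IH ?pm_mb // mbNr [in RHS]jacS; vec.
Qed.

Lemma jac_even n a x : pm a = a -> pm x = x -> dot a a = 1 ->
  jac (2 * n.+1) a x = (-1) ^+ n *: jac 2 a x.
Proof.
move=> ma mx a1; elim: n => [|n IH]; first by rewrite expr0 scale1r.
have e4 : (2 * n.+2 = (2 * n).+4)%N by rewrite !mulnS.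
have e2 : ((2 * n).+2 = 2 * n.+1)%N by rewrite mulnS.
by rewrite e4 jac_period // e2 IH exprS mulN1r scaleNr.
Qed.

Lemma jac_odd n a x : pm a = a -> pm x = x -> dot a a = 1 ->
  jac (2 * n + 1) a x = (-1) ^+ n *: jac 1 a x.
Proof.
move=> ma mx a1; elim: n => [|n IH]; first by rewrite expr0 scale1r.
have e3 : (2 * n.+1 + 1 = (2 * n).+3)%N by rewrite mulnS addn1.
by rewrite e3 jac_period // -[(2 * n).+1]addn1 IH exprS mulN1r scaleNr.
Qed.

End reductive.

(** * Derivatives of row-vector valued maps *)

Section rows.
Context {R : realType} {T : normedModType R}.

Lemma is_derive_unique {W : normedModType R} (f : T -> W) x v a b :
  is_derive x v f a -> is_derive x v f b -> a = b.
Proof. by move=> [_ <-] [_ <-]. Qed.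

Lemma is_derive_rowP {m} (f : T -> 'rV[R]_m) x v df :
  is_derive x v f df <-> forall j, is_derive x v (fun y => f y 0 j) (df 0 j).
Proof.
split=> [[fd <-] j|H].
  split; first by have /derivable_mxP := fd; apply.
  by rewrite derive_mx // mxE.
have fd : derivable f x v.
  by apply/derivable_mxP => i j; rewrite ord1; have [] := H j.
split=> //; rewrite derive_mx //; apply/rowP => j; rewrite mxE.
by have [] := H j.
Qed.

Lemma is_derive_sumE {W : normedModType R} m (F : 'I_m -> T -> W) x v dF :
  (forall i, is_derive x v (F i) (dF i)) ->
  is_derive x v (fun y => \sum_i F i y) (\sum_i dF i).
Proof.
move=> H; have -> : (fun y => \sum_i F i y) = \sum_i F i.
  by apply/funext => y; rewrite fct_sumE.
exact: is_derive_sum.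
Qed.

Lemma is_derive_mulr (f g : T -> R) x v df dg :
  is_derive x v f df -> is_derive x v g dg ->
  is_derive x v (fun y => f y * g y) (df * g x + f x * dg).
Proof.
move=> Hf Hg; apply: (is_derive_eq (is_deriveM Hf Hg)).
by rewrite addrC [df * _]mulrC.
Qed.

Lemma is_derive_cstmul (f : T -> R) x v df k :
  is_derive x v f df -> is_derive x v (fun y => f y * k) (df * k).
Proof.
move=> Hf; apply: (is_derive_eq (is_derive_mulr Hf (is_derive_cst k x v))).
by rewrite mulr0 addr0.
Qed.

Lemma row_linE {m p} (L : 'rV[R]_m -> 'rV[R]_p) :
  (forall a x y, L (a *: x + y) = a *: L x + L y) ->
  forall x, L x = \sum_i x 0 i *: L (delta_mx 0 i).
Proof.
move=> hL x.
have L0 : L 0 = 0.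
  have := hL 1 0 0; rewrite !scale1r addr0 => /eqP.
  by rewrite -subr_eq subrr => /eqP.
rewrite {1}[x]row_sum_delta; apply: (big_ind2 (fun a b => L a = b)) => //= [y1 z1 y2 z2 <- <-|i _].
  by have := hL 1 y1 y2; rewrite !scale1r.
by have := hL (x 0 i) (delta_mx 0 i) 0; rewrite !(addr0, L0).
Qed.

Lemma is_derive_lin {m p} (L : 'rV[R]_m -> 'rV[R]_p) (f : T -> 'rV[R]_m) x v df :
  (forall a x y, L (a *: x + y) = a *: L x + L y) ->
  is_derive x v f df -> is_derive x v (fun y => L (f y)) (L df).
Proof.
move=> hL /is_derive_rowP Hf; apply/is_derive_rowP => k.
have E y : L y 0 k = \sum_i y 0 i * L (delta_mx 0 i) 0 k.
  by rewrite {1}(row_linE hL y) summxE; apply: eq_bigr => i _; rewrite mxE.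
under eq_fun do rewrite E; rewrite E.
by apply: is_derive_sumE => i; exact: is_derive_cstmul.
Qed.

Lemma is_derive_bilin {m n p} (B : 'rV[R]_m -> 'rV[R]_n -> 'rV[R]_p)
    (f : T -> 'rV[R]_m) (g : T -> 'rV[R]_n) x v df dg :
  (forall a x y z, B (a *: x + y) z = a *: B x z + B y z) ->
  (forall a x y z, B z (a *: x + y) = a *: B z x + B z y) ->
  is_derive x v f df -> is_derive x v g dg ->
  is_derive x v (fun y => B (f y) (g y)) (B df (g x) + B (f x) dg).
Proof.
move=> hl hr /is_derive_rowP Hf /is_derive_rowP Hg; apply/is_derive_rowP => k.
have E y z : B y z 0 k = \sum_i \sum_j y 0 i * z 0 j * B (delta_mx 0 i) (delta_mx 0 j) 0 k.
  rewrite (row_linE (fun a y y' => hl a y y' z) y) summxE; apply: eq_bigr => i _.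
  rewrite mxE (row_linE (fun a y y' => hr a y y' (delta_mx 0 i)) z) summxE mulr_sumr.
  by apply: eq_bigr => j _; rewrite mxE mulrA.
under eq_fun do rewrite E; rewrite mxE !E -big_split /=.
apply: is_derive_sumE => i; rewrite -big_split /=.
apply: is_derive_sumE => j; rewrite -mulrDl.
by apply: is_derive_cstmul; exact: is_derive_mulr.
Qed.

Lemma is_derive_dot {m} (f g : T -> 'rV[R]_m) x v df dg :
  is_derive x v f df -> is_derive x v g dg ->
  is_derive x v (fun y => dot (f y) (g y)) (dot df (g x) + dot (f x) dg).
Proof.
move=> /is_derive_rowP Hf /is_derive_rowP Hg; rewrite /dot -big_split /=.
by apply: is_derive_sumE => i; exact: is_derive_mulr.
Qed.

Lemma is_derive_near {W : normedModType R} (f g : T -> W) x v df :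
  (\near x, f x = g x) -> is_derive x v g df -> is_derive x v f df.
Proof. by move=> fg; apply: near_eq_is_derive; apply: filterS fg => y ->. Qed.

Lemma derivable_det m (A : T -> 'M[R]_m) x v :
  (forall i j, derivable (fun y => A y i j) x v) -> derivable (fun y => \det (A y)) x v.
Proof.
move=> H; rewrite /determinant.
suff P (s : 'S_m) (r : seq 'I_m) : derivable (fun y => \prod_(i <- r) A y i (s i)) x v.
  have -> : (fun y => \sum_(s : 'S_m) (-1) ^+ s * \prod_i A y i (s i)) =
     \sum_(s : 'S_m) (fun y => (-1) ^+ s * \prod_i A y i (s i)).
    by apply/funext => y; rewrite fct_sumE.
  elim/big_ind: _ => [|f g|s _]; [exact: derivable_cst | exact: derivableD |].
  apply: (@derivableM _ _ (cst ((-1) ^+ s)) (fun y => \prod_i A y i (s i))); first exact: derivable_cst.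
  exact: P.
elim: r => [|i r IH].
  by under eq_fun do rewrite big_nil; exact: derivable_cst.
under eq_fun do rewrite big_cons.
exact: (@derivableM _ _ (fun y => A y i (s i)) (fun y => \prod_(j <- r) A y j (s j))).
Qed.

(** Cramer's rule: the solution of a linear system is a rational function of its
    coefficients. *)
Lemma derivable_solve m (A : T -> 'M[R]_m) (Y f : T -> 'rV[R]_m) x v :
  (forall i j, derivable (fun y => A y i j) x v) -> derivable f x v ->
  (\near x, A x \in unitmx /\ Y x *m A x = f x) -> derivable Y x v.
Proof.
move=> dA df H; have Ax : A x \in unitmx by have [] := nbhs_singleton H.
have H' : \near x, (fun y => (\det (A y))^-1 *: (f y *m \adj (A y))) x = Y x.
  apply: filterS H => y [uA <-].
  by rewrite -mulmxA mul_mx_adj mul_mx_scalar scalerA mulVr ?scale1r // -unitmxE.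
apply: near_eq_derivable H' _; apply/derivable_mxP => i j.
under eq_fun do rewrite !mxE.
apply: (@derivableM _ _ (fun y => (\det (A y))^-1) (fun y => \sum_k f y i k * \adj (A y) k j)).
  apply: derivableV; last exact: derivable_det.
  by rewrite -unitfE -unitmxE.
suff : is_derive x v (fun y => \sum_k f y i k * \adj (A y) k j)
  (\sum_k ('D_v (fun y => f y i k) x * \adj (A x) k j + f x i k * 'D_v (fun y => \adj (A y) k j) x)) by case.
apply: is_derive_sumE => k; apply: is_derive_mulr; apply/derivableP.
  by have /derivable_mxP := df; apply.
under eq_fun do rewrite mxE.
rewrite /cofactor.
apply: (@derivableM _ _ (cst _) (fun y => \det (row' j (col' k (A y))))); first exact: derivable_cst.
apply: derivable_det => a b.
under eq_fun do rewrite !mxE.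
exact: dA.
Qed.
End rows.

(** * Levi-Civita connection and curvature in a moving frame *)

Section frame.
Context {R : realType} {n N : nat}.
Local Notation V := 'rV[R]_n.
Local Notation g := 'rV[R]_N.
Variables (br : g -> g -> g) (pm : g -> g).
Hypothesis nr : naturally_reductive br pm.

(** The properties of the Maurer-Cartan form of a lift to the group that the
    geometry uses: it satisfies the structure equation, and its m-component is an
    isomorphism on each tangent space. *)
Record maurer_cartan_frame (U : set V) (om : V -> V -> g) : Prop := MaurerCartanFrame {
  om_open : open U;
  om_smooth : forall v k, smooth_on U (fun x => om x v 0 k);
  om_lin : forall x, U x -> forall a u v, om x (a *: u + v) = a *: om x u + om x v;
  om_eq : forall x, U x -> forall u v,
    'D_u (fun y => om y v) x - 'D_v (fun y => om y u) x = - br (om x u) (om x v);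
  om_inj : forall x, U x -> forall u, pm (om x u) = 0 -> u = 0 }.

Variables (U : set V) (om : V -> V -> g).
Hypothesis mc : maurer_cartan_frame U om.
(** P is an isomorphism from m to R^n; it makes the frame a square matrix, to be
    inverted. *)
Variable P : 'M[R]_(N, n).
Hypothesis PE : forall z, z *m P = 0 <-> pm z = 0.

Let oU : open U := om_open mc.

(** The trivialization of the tangent bundle by m, isometric by the choice of the
    metric. *)
Definition th x u : g := pm (om x u).

Lemma is_derive_pm {T : normedModType R} (f : T -> g) x v df :
  is_derive x v f df -> is_derive x v (fun y => pm (f y)) (pm df).
Proof. by apply: is_derive_lin; exact: pm_lin nr. Qed.

Lemma is_derive_br {T : normedModType R} (f h : T -> g) x v df dh :
  is_derive x v f df -> is_derive x v h dh ->
  is_derive x v (fun y => br (f y) (h y)) (br df (h x) + br (f x) dh).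
Proof.
apply: is_derive_bilin; first exact: br_linl nr.
by move=> a y y' z; rewrite (brDr nr) (brZr nr).
Qed.

Lemma is_derive_om x u v : U x ->
  is_derive x u (fun y => om y v) ('D_u (fun y => om y v) x).
Proof.
move=> Ux; apply/derivableP/derivable_mxP => i j; rewrite ord1.
exact (smooth_on_derivable (om_smooth mc v j) Ux).
Qed.

Lemma is_derive_th x u v : U x ->
  is_derive x u (fun y => th y v) (pm ('D_u (fun y => om y v) x)).
Proof. by move=> Ux; apply: is_derive_pm; exact: is_derive_om. Qed.

Lemma th_lin x : U x -> forall a u v, th x (a *: u + v) = a *: th x u + th x v.
Proof. by move=> Ux a u v; rewrite /th (om_lin mc Ux) (pm_lin nr). Qed.

Lemma pm_th x u : pm (th x u) = th x u.
Proof. exact: pm_idem nr _. Qed.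

Definition Theta x : 'M[R]_n := \matrix_i (om x (delta_mx 0 i) *m P).

Lemma mul_Theta x u : U x -> u *m Theta x = om x u *m P.
Proof.
move=> Ux; rewrite (row_linE (om_lin mc Ux) u) mulmx_suml mulmx_sum_row.
by apply: eq_bigr => i _; rewrite rowK scalemxAl.
Qed.

Lemma Theta_unit x : U x -> Theta x \in unitmx.
Proof.
move=> Ux; rewrite -row_free_unit; apply/inj_row_free => u.
by rewrite mul_Theta // => /PE; exact: (om_inj mc Ux).
Qed.

Lemma th_surj x z : U x -> exists u, th x u = pm z.
Proof.
move=> Ux; exists (z *m P *m invmx (Theta x)); set u := _ *m _.
have : u *m Theta x = z *m P by rewrite mulmxKV // Theta_unit.
rewrite mul_Theta // => /eqP; rewrite -subr_eq0 -mulmxBl => /eqP/PE.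
by rewrite (pmD nr) (pmN nr) => /eqP; rewrite subr_eq0 => /eqP.
Qed.

Lemma th_inj x u v : U x -> th x u = th x v -> u = v.
Proof.
move=> Ux E; apply/eqP; rewrite -subr_eq0; apply/eqP/(om_inj mc Ux).
by rewrite -/(th x (u - v)) [u - v]addrC -scaleN1r th_lin // E scaleN1r addNr.
Qed.

Lemma mulP_pm z : pm z *m P = z *m P.
Proof.
apply/eqP; rewrite -subr_eq0 -mulmxBl; apply/eqP/PE.
by rewrite (pmD nr) (pmN nr) (pm_idem nr) subrr.
Qed.

(** A field along a curve is derivable as soon as its components in the frame
    are. *)
Lemma derivable_lift (c : R -> V) (Y : R -> V) (f : R -> g) s :
  U (c s) -> derivable c s 1 -> derivable f s 1 ->
  (\near s, th (c s) (Y s) = f s) -> derivable Y s 1.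
Proof.
move=> Uc dc df H.
have nU : \near s, U (c s).
  have : {for s, continuous c} by exact/differentiable_continuous/derivable1_diffP.
  by apply; exact: open_nbhs_nbhs.
apply: (@derivable_solve _ _ _ (fun t => Theta (c t)) Y (fun t => f t *m P)).
- move=> i j; under eq_fun do rewrite mxE mxE.
  suff : is_derive s 1 (fun t => \sum_k om (c t) (delta_mx 0 i) 0 k * P k j)
     (\sum_k 'D_(derive1 c s) (fun y => om y (delta_mx 0 i) 0 k) (c s) * P k j) by case.
  apply: is_derive_sumE => k; apply: is_derive_cstmul.
  exact (C1_chain oU (om_smooth mc (delta_mx 0 i) k 1%N) Uc dc).
- have [] // : is_derive s 1 (fun t => f t *m P) ('D_1 f s *m P).
  apply: (is_derive_lin (L := fun z => z *m P)); last exact/derivableP.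
  by move=> a x y; rewrite mulmxDl scalemxAl.
apply: filterS2 nU H => t Ut E; split; first exact: Theta_unit.
by rewrite mul_Theta // -mulP_pm -/(th _ _) E.
Qed.

Section connection.
Variable G : V -> V -> V -> V.
Hypothesis LC : levi_civita U (fun x u v => dot (th x u) (th x v)) G.

Lemma G_lin1 x : U x -> forall a u v w, G x (a *: u + v) w = a *: G x u w + G x v w.
Proof. by move=> Ux; case: LC => -[_ /(_ x Ux)[]]. Qed.
Lemma covD_cst u v x : covD G (cst u) (cst v) x = G x u v.
Proof. by rewrite /covD derive_cst add0r. Qed.

Lemma G_sym x u v : U x -> G x u v = G x v u.
Proof.
move=> Ux; case: LC => _ /(_ (cst u) (cst v) (smooth_on_cst U u) (smooth_on_cst U v) x Ux) + _.
rewrite !covD_cst /lie !derive_cst subrr => /eqP; rewrite subr_eq0 => /eqP //.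
Qed.

Lemma G_metric x u v w : U x ->
  'D_u (fun y => dot (th y v) (th y w)) x =
  dot (th x (G x u v)) (th x w) + dot (th x v) (th x (G x u w)).
Proof.
move=> Ux; case: LC => _ _ /(_ (cst u) (cst v) (cst w) (smooth_on_cst U u) (smooth_on_cst U v) (smooth_on_cst U w) x Ux).
by rewrite !covD_cst.
Qed.

(** Koszul's argument: the difference S of both sides, paired with a third vector,
    is symmetric in its first two arguments since both connections are torsion
    free, and antisymmetric in its last two since both are metric, so it
    vanishes. *)
Lemma connection_frame x u v : U x ->
  th x (G x u v) = 'D_u (fun y => th y v) x + Lam br pm (om x u) (th x v).
Proof.
move=> Ux.
have Dth a b : 'D_a (fun y => th y b) x = pm ('D_a (fun y => om y b) x).
  by have [_] := is_derive_th a b Ux.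
pose S a b := th x (G x a b) - ('D_a (fun y => th y b) x + Lam br pm (om x a) (th x b)).
have pmS a b : pm (S a b) = S a b.
  by rewrite /S (pmD nr) (pmN nr) (pmD nr) pm_th Dth (pm_idem nr) (pm_Lam nr) // pm_th.
have Ssym a b : S a b = S b a.
  rewrite /S G_sym //; congr (_ - _); rewrite !Dth.
  have := om_eq mc Ux a b => /(congr1 pm); rewrite (pmD nr) !(pmN nr) -(Lam_torsion nr).
  move=> /eqP; rewrite opprB subr_eq => /eqP ->.
  by apply/rowP => k; rewrite /th !mxE; ring.
have Sskew a b d : dot (S a b) (th x d) + dot (th x b) (S a d) = 0.
  have [_] := is_derive_dot (is_derive_th a b Ux) (is_derive_th a d Ux).
  rewrite G_metric // -!Dth => E.
  have Ls := Lam_skew nr (om x a) (pm_th x b) (pm_th x d).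
  rewrite /S; move: (Lam _ _ _ _) (Lam _ _ _ _) Ls E => L1 L2 Ls E.
  by move: Ls E; rewrite !(dotDl, dotNl, dotDr, dotNr) /=; lra.
have T0 a b d : dot (S a b) (th x d) = 0.
  have sk a' b' d' : dot (S a' b') (th x d') = - dot (S a' d') (th x b').
    by have := Sskew a' b' d'; rewrite [dot (th _ _) _]dotC => /eqP; rewrite addr_eq0 => /eqP.
  (* Three exchanges of each kind bring the arguments back with a minus sign. *)
  suff : dot (S a b) (th x d) = - dot (S a b) (th x d) by lra.
  by rewrite {1}Ssym sk (Ssym b d) sk opprK (Ssym d a) sk (Ssym a b).
apply/eqP; rewrite -subr_eq0 -/(S u v); apply/eqP/dot_eq0.
by have [w Ew] := th_surj (S u v) Ux; rewrite -{2}pmS -Ew T0.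
Qed.

Lemma thD x u v : U x -> th x (u + v) = th x u + th x v.
Proof. by move=> Ux; have := th_lin Ux 1 u v; rewrite !scale1r. Qed.
Lemma thN x u : U x -> th x (- u) = - th x u.
Proof.
move=> Ux; apply/eqP; rewrite -addr_eq0 -thD // addNr.
by have := th_lin Ux (-1) 0 0; rewrite scaleN1r addr0 scaleN1r oppr0 addNr => ->.
Qed.

Lemma derive_th_lin x w : U x -> forall a u v,
  'D_w (fun y => th y (a *: u + v)) x = a *: 'D_w (fun y => th y u) x + 'D_w (fun y => th y v) x.
Proof.
move=> Ux a u v.
have E : \near x, th x (a *: u + v) = a *: th x u + th x v.
  by apply: (open_eq_near oU Ux) => y Uy; exact: th_lin.
have D b : is_derive x w (fun y => th y b) ('D_w (fun y => th y b) x).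
  by have [D _] := is_derive_th w b Ux; exact: derivableP D.
have [_] := is_derive_near E (is_deriveD (is_deriveZ a (D u)) (D v)); exact: id.
Qed.

(** Product rule for the frame components of a field; it serves both for fields on
    U (c = id) and for fields along a curve. *)
Lemma is_derive_th_comp {T : normedModType R} (c Y : T -> V) s d w dY :
  U (c s) -> (\near s, U (c s)) ->
  (forall v, is_derive s d (fun t => th (c t) v) ('D_w (fun y => th y v) (c s))) ->
  is_derive s d Y dY ->
  is_derive s d (fun t => th (c t) (Y t)) (th (c s) dY + 'D_w (fun y => th y (Y s)) (c s)).
Proof.
move=> Uc nU Hc /is_derive_rowP HY; apply/is_derive_rowP => k.
have E : \near s, th (c s) (Y s) 0 k = \sum_i Y s 0 i * th (c s) (delta_mx 0 i) 0 k.
  apply: filterS nU => t Ut; rewrite {1}(row_linE (th_lin Ut) (Y t)) summxE.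
  by apply: eq_bigr => i _; rewrite mxE.
apply: (is_derive_near E).
rewrite mxE (row_linE (th_lin Uc) dY) (row_linE (derive_th_lin w Uc) (Y s)) !summxE -big_split /=.
apply: is_derive_sumE => i; rewrite !(mxE _ _ 0 k).
apply: (is_derive_mulr (HY i)).
have /is_derive_rowP := Hc (delta_mx 0 i); exact.
Qed.

Lemma th_covD_field x u (Y : V -> V) : U x -> derivable Y x u ->
  th x ('D_u Y x + G x u (Y x)) =
  'D_u (fun y => th y (Y y)) x + Lam br pm (om x u) (th x (Y x)).
Proof.
move=> Ux dY.
have := is_derive_th_comp (c := id) (w := u) Ux (open_nbhs_nbhs (conj oU Ux)) _ (derivableP dY).
case=> [v|_ ->]; first by have [D ->] := is_derive_th u v Ux; exact: is_derive_th.
by rewrite thD // connection_frame // addrA.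
Qed.

Lemma near_curve (c : R -> V) s : U (c s) -> derivable c s 1 -> \near s, U (c s).
Proof.
move=> Uc dc.
have : {for s, continuous c} by exact/differentiable_continuous/derivable1_diffP.
by apply; exact: open_nbhs_nbhs.
Qed.

Lemma is_derive_th_curve (c Y : R -> V) s : U (c s) -> derivable c s 1 -> derivable Y s 1 ->
  is_derive s 1 (fun t => th (c t) (Y t))
   (th (c s) (covDt G c Y s) - Lam br pm (om (c s) (derive1 c s)) (th (c s) (Y s))).
Proof.
move=> Uc dc dY.
have := is_derive_th_comp (w := derive1 c s) Uc (near_curve Uc dc) _ (derivableP dY).
case=> [v|D E].
  have [_ ->] := is_derive_th (derive1 c s) v Uc; apply: is_derive_pm.
  apply/is_derive_rowP => k.
  have [/derivable_mxP H _] := is_derive_om (derive1 c s) v Uc.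
  rewrite derive_mx; last exact/derivable_mxP.
  rewrite mxE; exact (C1_chain oU (om_smooth mc v k 1%N) Uc dc).
split=> //; rewrite E /covDt (derive1E Y) thD // connection_frame //.
by rewrite addrA addrK.
Qed.

Lemma is_derive_om2 x u v w : U x ->
  is_derive x u (fun y => 'D_v (fun z => om z w) y)
    (\row_k 'D_u (fun y => 'D_v (fun z => om z w 0 k) y) x).
Proof.
move=> Ux; apply/is_derive_rowP => k; rewrite mxE.
have E : \near x, ('D_v (fun z => om z w) x) 0 k = 'D_v (fun z => om z w 0 k) x.
  apply: (open_eq_near oU Ux) => y Uy.
  by have [D _] := is_derive_om v w Uy; rewrite derive_mx // mxE.
apply: (is_derive_near E); apply/derivableP.
exact (smooth_on_derivable (smooth_on_derive v (om_smooth mc w k)) Ux).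
Qed.

(** For the constant fields the Lie bracket vanishes, and the second derivatives of
    the frame cancel by symmetry; what remains is the formula of
    Lam_frame_curv. *)
Lemma riem_frame x u v w : U x ->
  th x (Riem G x u v w) = curv br pm (th x u) (th x v) (th x w).
Proof.
move=> Ux.
have G0 : G x 0 w = 0.
  have := G_lin1 Ux 1 0 0 w; rewrite !scale1r addr0 => /eqP.
  by rewrite -subr_eq subrr => /eqP.
have cG a : covD G (cst a) (cst w) = (fun y => G y a w).
  by apply/funext => y; rewrite covD_cst.
have dG a b : derivable (fun y => G y a w) x b.
  by case: LC => -[sG _ _ _]; exact (smooth_on_derivable (sG a w) Ux).
have -> : Riem G x u v w = ('D_u (fun y => G y v w) x + G x u (G x v w))
   - ('D_v (fun y => G y u w) x + G x v (G x u w)).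
  rewrite /Riem /curvature !cG {3}/covD /lie !derive_cst subrr G0 addr0 subr0.
  by rewrite /covD.
pose D a b := \row_k 'D_a (fun y => 'D_b (fun z => om z w 0 k) y) x.
have Dsym : D u v = D v u.
  apply/rowP => k. rewrite [LHS]mxE. rewrite [RHS]mxE.
  exact (schwarz u v oU (om_smooth mc w k 2%N) Ux).
have DG a b : 'D_a (fun y => th y (G y b w)) x =
    pm (D a b) + (Lam br pm ('D_a (fun y => om y b) x) (th x w) +
                  Lam br pm (om x b) ('D_a (fun y => th y w) x)).
  have E : \near x, th x (G x b w) = pm ('D_b (fun z => om z w) x) + Lam br pm (om x b) (th x w).
    apply: (open_eq_near oU Ux) => y Uy.
    rewrite (connection_frame _ _ Uy).
    have [_ Eb] := is_derive_th b w Uy.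
    by rewrite Eb.
  rewrite (near_eq_derive _ E).
  suff [] : is_derive x a (fun y => pm ('D_b (fun z => om z w) y) + Lam br pm (om y b) (th y w))
    (pm (D a b) + (Lam br pm ('D_a (fun y => om y b) x) (th x w) +
                  Lam br pm (om x b) ('D_a (fun y => th y w) x))) by [].
  apply: is_deriveD; first by apply: is_derive_pm; exact: is_derive_om2.
  apply: is_derive_bilin; [by move=> *; exact: Lam_linl|by move=> *; exact: Lam_linr| exact: is_derive_om|].
  by have [_ ->] := is_derive_th a w Ux; exact: is_derive_th.
rewrite (thD _ _ Ux) (thN _ Ux).
rewrite (th_covD_field Ux (dG v u)) (th_covD_field Ux (dG u v)) !DG Dsym.
rewrite !(connection_frame _ _ Ux).
have LD X Z Z' : Lam br pm X (Z + Z') = Lam br pm X Z + Lam br pm X Z'.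
  by have := Lam_linr nr 1 X Z Z'; rewrite !scale1r.
rewrite -[curv _ _ _ _ _](Lam_frame_curv nr (om x u) (om x v)) -(om_eq mc Ux).
have LB A B Z : Lam br pm (A - B) Z = Lam br pm A Z - Lam br pm B Z.
  by have := Lam_linl nr (-1) B A Z; rewrite !scaleN1r [- B + A]addrC [- _ + Lam _ _ _ _]addrC.
rewrite LB (LD _ ('D_v _ x)) (LD _ ('D_u _ x)).
move: (pm (D v u)) (Lam br pm ('D_u _ x) _) (Lam br pm ('D_v _ x) _).
move: (Lam br pm _ ('D_u _ x)) (Lam br pm _ ('D_v _ x)).
move: (Lam br pm _ (Lam _ _ _ _)) (Lam br pm _ (Lam _ _ _ _)) => a1 a2 a3 a4 a5 a6 a7.
by apply/rowP => k; rewrite !mxE; ring.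
Qed.

Section equivariant.
Variables (X : g) (s : R).
Local Notation e := (ph pm X).

(** f1 is the derivative of f corrected by the h-part of the connection.  The rules
    below say that maps built from the bracket and from pm commute with this
    operation, because ad X_h is a derivation that preserves m. *)
Definition eqder (f : R -> g) (f1 : g) : Prop := is_derive s 1 f (f1 - br e (f s)).

Lemma eqder_br f h f1 h1 : eqder f f1 -> eqder h h1 ->
  eqder (fun t => br (f t) (h t)) (br f1 (h s) + br (f s) h1).
Proof.
move=> Df Dh; apply: (is_derive_eq (is_derive_br Df Dh)).
rewrite (brDl nr) (brDr nr) (brNl nr) (brNr nr) (br_jacobi nr e (f s) (h s)).
by move: (br _ _) (br _ _) (br _ _) (br _ _) => a b c d; apply/rowP => k; rewrite !mxE; ring.
Qed.

Lemma eqder_pm f f1 : eqder f f1 -> eqder (fun t => pm (f t)) (pm f1).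
Proof.
move=> Df; apply: (is_derive_eq (is_derive_pm Df)).
by rewrite (pmD nr) (pmN nr) -(br_h_pm nr).
Qed.

Lemma eqder_sub f h f1 h1 : eqder f f1 -> eqder h h1 ->
  eqder (fun t => f t - h t) (f1 - h1).
Proof.
move=> Df Dh; apply: (is_derive_eq (is_deriveB Df Dh)).
rewrite (brDr nr) (brNr nr); move: (br _ _) (br _ _) => a b.
by apply/rowP => k; rewrite !mxE; ring.
Qed.

Lemma eqder_scale k f f1 : eqder f f1 -> eqder (fun t => k *: f t) (k *: f1).
Proof.
move=> Df; apply: (is_derive_eq (is_deriveZ k Df)).
by rewrite (brZr nr) scalerBr.
Qed.

Lemma eqder_eq f f1 f2 : f1 = f2 -> eqder f f1 -> eqder f f2.
Proof. by move=> ->. Qed.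

Lemma eqder_mb f h f1 h1 : eqder f f1 -> eqder h h1 ->
  eqder (fun t => mb br pm (f t) (h t)) (mb br pm f1 (h s) + mb br pm (f s) h1).
Proof.
move=> Df Dh; apply: (eqder_eq _ (eqder_pm (eqder_br Df Dh))).
by rewrite (pmD nr).
Qed.

Lemma eqder_ph f f1 : eqder f f1 -> eqder (fun t => ph pm (f t)) (ph pm f1).
Proof. by move=> Df; exact: eqder_sub Df (eqder_pm Df). Qed.

Lemma eqder_curv x y z x1 y1 z1 : eqder x x1 -> eqder y y1 -> eqder z z1 ->
  eqder (fun t => curv br pm (x t) (y t) (z t))
    (curv br pm x1 (y s) (z s) + curv br pm (x s) y1 (z s) + curv br pm (x s) (y s) z1).
Proof.
move=> Dx Dy Dz.
apply: (eqder_eq _ (eqder_sub (eqder_sub (eqder_scale 4^-1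
   (eqder_sub (eqder_mb Dx (eqder_mb Dy Dz)) (eqder_mb Dy (eqder_mb Dx Dz))))
   (eqder_br (eqder_ph (eqder_br Dx Dy)) Dz)) (eqder_scale 2^-1 (eqder_mb (eqder_mb Dx Dy) Dz)))).
rewrite /curv (phD nr) (brDl nr (ph _ _) (ph _ _)) !(mbDl nr, mbDr nr).
do !move: (br _ _) => ?; do !move: (mb _ _ _ _) => ?.
by apply/rowP => k; rewrite !mxE; field.
Qed.

Lemma eqder_cjet i a x y z x1 y1 z1 : eqder a 0 -> eqder x x1 -> eqder y y1 -> eqder z z1 ->
  eqder (fun t => cjet br pm i (a t) (x t) (y t) (z t))
    (cjet br pm i (a s) x1 (y s) (z s) + cjet br pm i (a s) (x s) y1 (z s)
     + cjet br pm i (a s) (x s) (y s) z1).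
Proof.
move=> Da; elim: i x y z x1 y1 z1 => [|i IH] x y z x1 y1 z1 Dx Dy Dz.
  exact: eqder_curv.
have mD f f1 : eqder f f1 -> eqder (fun t => mb br pm (a t) (f t)) (mb br pm (a s) f1).
  by move=> Df; apply: (eqder_eq _ (eqder_mb Da Df)); rewrite (mb0l nr) add0r.
apply: (eqder_eq _ (eqder_scale 2^-1 (eqder_sub (eqder_sub (eqder_sub
   (mD _ _ (IH _ _ _ _ _ _ Dx Dy Dz)) (IH _ _ _ _ _ _ (mD _ _ Dx) Dy Dz))
   (IH _ _ _ _ _ _ Dx (mD _ _ Dy) Dz)) (IH _ _ _ _ _ _ Dx Dy (mD _ _ Dz))))).
rewrite /= !(mbDr nr).
do !move: (mb _ _ _ (cjet _ _ _ _ _ _ _)) => ?; do !move: (cjet _ _ _ _ _ _ _) => ?.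
by apply/rowP => k; rewrite !mxE; field.
Qed.
End equivariant.

Section geodesic.
Variables (W : set R) (c : R -> V).
Hypothesis oW : open W.
Hypothesis cU : forall s, W s -> U (c s).
Hypothesis dc : forall s, W s -> derivable c s 1.
Hypothesis ddc : forall s, W s -> derivable (derive1 c) s 1.
Hypothesis geo : forall s, W s -> covDt G c (derive1 c) s = 0.

Definition vel s := th (c s) (derive1 c s).

Lemma Lam_vel s z : Lam br pm (om (c s) (derive1 c s)) z =
  br (ph pm (om (c s) (derive1 c s))) z + 2^-1 *: mb br pm (vel s) z.
Proof. by []. Qed.

Lemma eqder_curve (Y : R -> V) s : W s -> derivable Y s 1 ->
  eqder (om (c s) (derive1 c s)) s (fun t => th (c t) (Y t))
    (th (c s) (covDt G c Y s) - 2^-1 *: mb br pm (vel s) (th (c s) (Y s))).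
Proof.
move=> Ws dY; apply: (is_derive_eq (is_derive_th_curve (cU Ws) (dc Ws) dY)).
by rewrite Lam_vel opprD addrA addrAC.
Qed.

Lemma th0 x : U x -> th x 0 = 0.
Proof. by move=> Ux; have := thD 0 0 Ux; rewrite addr0 -{1}[th x 0]addr0 => /addrI. Qed.

(** The geodesic equation: the velocity is parallel, and [a, a]_m = 0 makes the
    m-part of the connection disappear. *)
Lemma eqder_vel s : W s -> eqder (om (c s) (derive1 c s)) s vel 0.
Proof.
move=> Ws; apply: (eqder_eq _ (eqder_curve Ws (ddc Ws))).
by rewrite geo // (th0 (cU Ws)) (mbxx nr) scaler0 subrr.
Qed.

(** Induction on i.  Both the m-part of the connection on the values of the tensor
    and the corrections in its three arguments are of the form 1/2 [a, .]_m, which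
    is what cjet collects. *)
Lemma jet_frame i s u v w : W s ->
  th (c s) (iter i (covDt_tensor G c) (fun s => Riem G (c s)) s u v w) =
  cjet br pm i (vel s) (th (c s) u) (th (c s) v) (th (c s) w).
Proof.
elim: i s u v w => [|i IH] s u v w Ws; first exact: riem_frame (cU Ws).
rewrite iterS; set T := iter i _ _ in IH *.
have Dc b : eqder (om (c s) (derive1 c s)) s (fun t => th (c t) b)
    (th (c s) (covDt G c (cst b) s) - 2^-1 *: mb br pm (vel s) (th (c s) b)).
  exact: eqder_curve Ws (derivable_cst b s 1).
have DF := eqder_cjet i (eqder_vel Ws) (Dc u) (Dc v) (Dc w).
have E : \near s, th (c s) (T s u v w) =
    cjet br pm i (vel s) (th (c s) u) (th (c s) v) (th (c s) w).
  by apply: (open_eq_near oW Ws) => t Wt; exact: IH.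
have dT : derivable (fun t => T t u v w) s 1.
  by case: DF => dF _; exact: derivable_lift (cU Ws) (dc Ws) dF E.
have := eqder_curve Ws dT; move/(is_derive_unique (is_derive_near E DF)).
rewrite (IH s u v w Ws) => /addIr EQ.
have -> : th (c s) (covDt_tensor G c T s u v w) =
    th (c s) (covDt G c (fun t => T t u v w) s)
    - th (c s) (T s (covDt G c (cst u) s) v w)
    - th (c s) (T s u (covDt G c (cst v) s) w)
    - th (c s) (T s u v (covDt G c (cst w) s)).
  by rewrite /covDt_tensor !(thD _ _ (cU Ws)) !(thN _ (cU Ws)).
rewrite !(IH s _ _ _ Ws) /=.
have l1 p q y z : cjet br pm i (vel s) (p - 2^-1 *: q) y z =
    cjet br pm i (vel s) p y z - 2^-1 *: cjet br pm i (vel s) q y z.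
  by rewrite addrC -scaleNr (cjet_lin1 nr) scaleNr addrC.
have l2 p q y z : cjet br pm i (vel s) y (p - 2^-1 *: q) z =
    cjet br pm i (vel s) y p z - 2^-1 *: cjet br pm i (vel s) y q z.
  by rewrite addrC -scaleNr (cjet_lin2 nr) scaleNr addrC.
have l3 p q y z : cjet br pm i (vel s) y z (p - 2^-1 *: q) =
    cjet br pm i (vel s) y z p - 2^-1 *: cjet br pm i (vel s) y z q.
  by rewrite addrC -scaleNr (cjet_lin3 nr) scaleNr addrC.
move: EQ; rewrite l1 l2 l3.
move: (th (c s) (covDt G c (fun t => T t u v w) s)) (mb _ _ _ (cjet _ _ _ _ _ _ _)).
do !move: (cjet _ _ _ _ _ _ _) => ?.
move=> a b EQ; apply/rowP => k; move/rowP/(_ k): EQ; rewrite !mxE; lra.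
Qed.

Lemma jacobi_frame i s u : W s ->
  th (c s) (jacobi_op G c i s u) = jac br pm i (vel s) (th (c s) u).
Proof. exact: jet_frame. Qed.

Hypothesis cross : forall a x, pm a = a -> pm x = x ->
  mb br pm a (mb br pm a x) = dot a x *: a - dot a a *: x.

Lemma thZ x a u : U x -> th x (a *: u) = a *: th x u.
Proof. by move=> Ux; have := th_lin Ux a u 0; rewrite addr0 (th0 Ux) addr0. Qed.

Lemma jacobi_even s n' u : W s -> dot (vel s) (vel s) = 1 ->
  jacobi_op G c (2 * n'.+1) s u = (-1) ^+ n' *: jacobi_op G c 2 s u.
Proof.
move=> Ws v1; apply: (th_inj (cU Ws)); rewrite (thZ _ _ (cU Ws)) !(jacobi_frame _ _ Ws).
exact: (jac_even nr cross n' (pm_th _ _) (pm_th _ _) v1).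
Qed.

Lemma jacobi_odd s n' u : W s -> dot (vel s) (vel s) = 1 ->
  jacobi_op G c (2 * n' + 1) s u = (-1) ^+ n' *: jacobi_op G c 1 s u.
Proof.
move=> Ws v1; apply: (th_inj (cU Ws)); rewrite (thZ _ _ (cU Ws)) !(jacobi_frame _ _ Ws).
exact: (jac_odd nr cross n' (pm_th _ _) (pm_th _ _) v1).
Qed.
End geodesic.
End connection.
End frame.

(** * Coordinates on the Lie algebra sp(2) *)

Ltac case4 := case=> [|[|[|[|//]]]].

Section complex_parts.
Local Open Scope complex_scope.
Context {R : realType}.
Implicit Types x y : R[i].

Lemma complex_ext x y : complex.Re x = complex.Re y -> complex.Im x = complex.Im y -> x = y.
Proof. by case: x y => [a b] [c d] /= -> ->. Qed.
Lemma cReD x y : complex.Re (x + y) = complex.Re x + complex.Re y.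
Proof. by case: x y => [a b] [c d]. Qed.
Lemma cImD x y : complex.Im (x + y) = complex.Im x + complex.Im y.
Proof. by case: x y => [a b] [c d]. Qed.
Lemma cReN x : complex.Re (- x) = - complex.Re x.
Proof. by case: x. Qed.
Lemma cImN x : complex.Im (- x) = - complex.Im x.
Proof. by case: x. Qed.
Lemma cReM x y : complex.Re (x * y) = complex.Re x * complex.Re y - complex.Im x * complex.Im y.
Proof. by case: x y => [a b] [c d]. Qed.
Lemma cImM x y : complex.Im (x * y) = complex.Re x * complex.Im y + complex.Im x * complex.Re y.
Proof. by case: x y => [a b] [c d]. Qed.
Lemma cRe_nat n : complex.Re (n%:R : R[i]) = n%:R.
Proof. by elim: n => // n IH; rewrite -addn1 !natrD cReD IH. Qed.
Lemma cIm_nat n : complex.Im (n%:R : R[i]) = 0.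
Proof. by elim: n => // n IH; rewrite -addn1 !natrD cImD IH addr0. Qed.
Lemma cRe0 : complex.Re (0 : R[i]) = 0. Proof. by []. Qed.
Lemma cIm0 : complex.Im (0 : R[i]) = 0. Proof. by []. Qed.
Definition cE := (cReD, cImD, cReN, cImN, cReM, cImM, cRe_nat, cIm_nat, cRe0, cIm0).
End complex_parts.

Section sp2_coordinates.
Local Open Scope complex_scope.
Context {R : realType}.
Local Notation M4 := 'M[R[i]]_4.
Local Notation g := 'rV[R]_10.
Implicit Types s t : nat -> R.

Definition sp2_entry s (i j : nat) : R[i] :=
  nth 0 (nth [::] [::
    [:: 0 +i* s 0; s 2 +i* s 3; s 6 +i* s 7; s 8 +i* s 9];
    [:: (- s 2) +i* s 3; 0 +i* (- s 0); s 8 +i* (- s 9); (- s 6) +i* s 7];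
    [:: (- s 6) +i* s 7; (- s 8) +i* (- s 9); 0 +i* s 1; s 4 +i* s 5];
    [:: (- s 8) +i* s 9; s 6 +i* s 7; (- s 4) +i* s 5; 0 +i* (- s 1)]] i) j.

(** The element of sp(2) with coordinates s in the basis S1, ..., S10. *)
Definition sp2 s : M4 := \matrix_(i, j) sp2_entry s i j.

Lemma matrix4P (A B : M4) :
  (forall i j : nat, (i < 4)%N -> (j < 4)%N -> A (inord i) (inord j) = B (inord i) (inord j)) -> A = B.
Proof.
by move=> H; apply/matrixP => i j; rewrite -(inord_val i) -(inord_val j); exact: H.
Qed.

Lemma sum4 (F : 'I_4 -> R[i]) : \sum_i F i =
  F (inord 0) + (F (inord 1) + (F (inord 2) + F (inord 3))).
Proof.
rewrite !big_ord_recl big_ord0 addr0.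
by do ?[congr (_ + _)]; congr (F _); apply/val_inj; rewrite /= inordK.
Qed.

Lemma sp2E s i j : (i < 4)%N -> (j < 4)%N -> sp2 s (inord i) (inord j) = sp2_entry s i j.
Proof. by move=> i4 j4; rewrite mxE !inordK. Qed.

Lemma E_entry k l i j : (0 < k <= 4)%N -> (0 < l <= 4)%N -> (i < 4)%N -> (j < 4)%N ->
  @E R k l (inord i) (inord j) = ((i == k.-1) && (j == l.-1))%:R.
Proof.
case: k l => [//|k] [//|l] /= k4 l4 i4 j4.
by rewrite /E mxE -!val_eqE /= !inordK.
Qed.


(** Coordinates of the commutator in the basis S1, ..., S10. *)
Definition sp2_br s t : nat -> R := nth 0 [::
    2 * (s 2 * t 3 - s 3 * t 2) + 2 * (s 6 * t 7 - s 7 * t 6) + 2 * (s 8 * t 9 - s 9 * t 8);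
    2 * (s 4 * t 5 - s 5 * t 4) - 2 * (s 6 * t 7 - s 7 * t 6) + 2 * (s 8 * t 9 - s 9 * t 8);
    - 2 * (s 0 * t 3 - s 3 * t 0) - 2 * (s 6 * t 8 - s 8 * t 6) + 2 * (s 7 * t 9 - s 9 * t 7);
    2 * (s 0 * t 2 - s 2 * t 0) - 2 * (s 6 * t 9 - s 9 * t 6) - 2 * (s 7 * t 8 - s 8 * t 7);
    - 2 * (s 1 * t 5 - s 5 * t 1) - 2 * (s 6 * t 8 - s 8 * t 6) - 2 * (s 7 * t 9 - s 9 * t 7);
    2 * (s 1 * t 4 - s 4 * t 1) - 2 * (s 6 * t 9 - s 9 * t 6) + 2 * (s 7 * t 8 - s 8 * t 7);
    - (s 0 * t 7 - s 7 * t 0) + (s 1 * t 7 - s 7 * t 1) + (s 2 * t 8 - s 8 * t 2) + (s 3 * t 9 - s 9 * t 3) + (s 4 * t 8 - s 8 * t 4) + (s 5 * t 9 - s 9 * t 5);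
    (s 0 * t 6 - s 6 * t 0) - (s 1 * t 6 - s 6 * t 1) - (s 2 * t 9 - s 9 * t 2) + (s 3 * t 8 - s 8 * t 3) + (s 4 * t 9 - s 9 * t 4) - (s 5 * t 8 - s 8 * t 5);
    - (s 0 * t 9 - s 9 * t 0) - (s 1 * t 9 - s 9 * t 1) - (s 2 * t 6 - s 6 * t 2) - (s 3 * t 7 - s 7 * t 3) - (s 4 * t 6 - s 6 * t 4) + (s 5 * t 7 - s 7 * t 5);
    (s 0 * t 8 - s 8 * t 0) + (s 1 * t 8 - s 8 * t 1) + (s 2 * t 7 - s 7 * t 2) - (s 3 * t 6 - s 6 * t 3) - (s 4 * t 7 - s 7 * t 4) - (s 5 * t 6 - s 6 * t 5)].

Lemma sp2_commutator s t : sp2 s *m sp2 t - sp2 t *m sp2 s = sp2 (sp2_br s t).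
Proof.
apply: matrix4P => i j i4 j4.
rewrite [LHS]mxE [X in _ + X]mxE ![(_ *m _) _ _]mxE !sum4 !sp2E //.
move: i j i4 j4; case4; case4 => _ _; rewrite /sp2_entry /sp2_br /=;
  apply: complex_ext; rewrite !cE /=; ring.
Qed.

Definition sp2_ip s t : R :=
  2 / 5 * (s 0 * t 0 + s 1 * t 1 + s 2 * t 2 + s 3 * t 3 + s 4 * t 4 + s 5 * t 5)
  + 4 / 5 * (s 6 * t 6 + s 7 * t 7 + s 8 * t 8 + s 9 * t 9).

Lemma ip_sp2 s t : ip (sp2 s) (sp2 t) = sp2_ip s t.
Proof.
rewrite /ip /mxtrace sum4 ![(_ *m _) _ _]mxE !sum4 !sp2E // /sp2_entry /sp2_ip /= ?cE /=.
by field.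
Qed.
Lemma mxDE (A B : M4) i j : (A + B) i j = A i j + B i j. Proof. by rewrite mxE. Qed.
Lemma mxNE (A : M4) i j : (- A) i j = - A i j. Proof. by rewrite mxE. Qed.
Lemma mxZE a (A : M4) i j : (a *: A) i j = a * A i j. Proof. by rewrite mxE. Qed.

Local Notation a2 := (Num.sqrt 2 : R).
Local Notation a3 := (Num.sqrt 3 : R).
Local Notation a5 := (Num.sqrt 5 : R).

Definition Qs : seq M4 := [:: Q1 R; Q2 R; Q3 R; Q4 R; Q5 R; Q6 R; Q7 R; Q8 R; Q9 R; Q10 R].

(** Coordinates of Q1, ..., Q10 in the basis S1, ..., S10, with sqrt (5/2) and
    sqrt 6 expressed by the square roots of 2, 3 and 5, so that identities between
    them reduce to polynomial ones. *)
Definition Qc (k : nat) : nat -> R := nth 0 (nth [::] [::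
  [:: 1 / 2; - (3 / 2)];
  [:: 0; 0; a5 * a2 / 2];
  [:: 0; 0; 0; a5 * a2 / 2];
  [:: 0; 0; 0; 0; a2 * a3 / 2; 0; - (a2 / 2)];
  [:: 0; 0; 0; 0; 0; a2 * a3 / 2; 0; - (a2 / 2)];
  [:: 0; 0; 0; 0; 0; 0; 0; 0; a5 / 2];
  [:: 0; 0; 0; 0; 0; 0; 0; 0; 0; a5 / 2];
  [:: 3 / 2; 1 / 2];
  [:: 0; 0; 0; 0; 1; 0; a3 / 2];
  [:: 0; 0; 0; 0; 0; 1; 0; a3 / 2]] k).

Lemma sqrt6E : Num.sqrt 6 = a2 * a3.
Proof. by rewrite -sqrtrM ?ler0n // -natrM. Qed.

Lemma sqrt52E : Num.sqrt (5 / 2) = a5 * a2 / 2 :> R.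
Proof.
have -> : 5 / 2 = (a5 * a2 / 2) ^+ 2 :> R.
  by rewrite !exprMn !sqr_sqrtr ?ler0n //; field.
by rewrite sqrtr_sqr ger0_norm // divr_ge0 // mulr_ge0 // sqrtr_ge0.
Qed.

Lemma sq2 : a2 ^+ 2 = 2. Proof. by rewrite sqr_sqrtr ?ler0n. Qed.
Lemma sq3 : a3 ^+ 2 = 3. Proof. by rewrite sqr_sqrtr ?ler0n. Qed.
Lemma sq5 : a5 ^+ 2 = 5. Proof. by rewrite sqr_sqrtr ?ler0n. Qed.

Lemma sp2_ext s t : (forall k, (k < 10)%N -> s k = t k) -> sp2 s = sp2 t.
Proof.
by move=> H; apply/matrixP => i j; rewrite !mxE /sp2_entry !H.
Qed.

Lemma sp2Z a s : real_complex R a *: sp2 s = sp2 (fun k => a * s k).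
Proof.
apply: matrix4P => i j i4 j4; rewrite mxZE !sp2E //.
move: i j i4 j4; case4; case4 => _ _; rewrite /sp2_entry /=;
  apply: complex_ext; rewrite cE /=; ring.
Qed.

Lemma sp2D s t : sp2 s + sp2 t = sp2 (fun k => s k + t k).
Proof.
apply: matrix4P => i j i4 j4; rewrite mxDE !sp2E //.
move: i j i4 j4; case4; case4 => _ _; rewrite /sp2_entry /=;
  apply: complex_ext; rewrite cE /=; ring.
Qed.

Lemma sp2N s : - sp2 s = sp2 (fun k => - s k).
Proof.
have -> : - sp2 s = real_complex R (-1) *: sp2 s by rewrite rmorphN1 scaleN1r.
by rewrite sp2Z; apply: sp2_ext => k _; rewrite mulN1r.
Qed.

Definition delta (l k : nat) : R := (k == l)%:R.

Lemma sp2P (A : M4) s : (forall i j : nat, (i < 4)%N -> (j < 4)%N ->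
  A (inord i) (inord j) = sp2_entry s i j) -> A = sp2 s.
Proof. by move=> H; apply: matrix4P => i j i4 j4; rewrite sp2E // H. Qed.

Ltac Sentries := apply: sp2P; case4; case4 => _ _;
  rewrite !(mxDE, mxNE, mxZE) !E_entry //; rewrite /sp2_entry /delta /=;
  apply: complex_ext; rewrite ?cE /=; ring.

Lemma S1E : S1 R = sp2 (delta 0). Proof. Sentries. Qed.
Lemma S2E : S2 R = sp2 (delta 1). Proof. Sentries. Qed.
Lemma S3E : S3 R = sp2 (delta 2). Proof. Sentries. Qed.
Lemma S4E : S4 R = sp2 (delta 3). Proof. Sentries. Qed.
Lemma S5E : S5 R = sp2 (delta 4). Proof. Sentries. Qed.
Lemma S6E : S6 R = sp2 (delta 5). Proof. Sentries. Qed.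
Lemma S7E : S7 R = sp2 (delta 6). Proof. Sentries. Qed.
Lemma S8E : S8 R = sp2 (delta 7). Proof. Sentries. Qed.
Lemma S9E : S9 R = sp2 (delta 8). Proof. Sentries. Qed.
Lemma S10E : S10 R = sp2 (delta 9). Proof. Sentries. Qed.

Lemma Qs_sp2 k : (k < 10)%N -> nth 0 Qs k = sp2 (Qc k).
Proof.
do 10?[case: k => [_|k]; first (
  rewrite /Qs /= /Q1 /Q2 /Q3 /Q4 /Q5 /Q6 /Q7 /Q8 /Q9 /Q10;
  rewrite ?(S1E, S2E, S3E, S4E, S5E, S6E, S7E, S8E, S9E, S10E, sqrt6E, sqrt52E, sp2Z, sp2N, sp2D);
  apply: sp2_ext => l; rewrite /Qc /delta;
  do 10?[case: l => [_|l] /=; first ring]; by [])].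
by [].
Qed.

Definition phi (X : g) : nat -> R := fun l => \sum_(k < 10) X 0 k * Qc k l.

End sp2_coordinates.

(** mat and Qcoord are the mutually inverse isomorphisms between R^10 and sp(2)
    given by the orthonormal basis Q1, ..., Q10.  They are locked because their
    unfolded forms are too large to be compared during unification. *)
HB.lock Definition mat (R : realType) (X : 'rV[R]_10) : 'M[R[i]]_4 := sp2 (phi X).

HB.lock Definition Qcoord (R : realType) (A : 'M[R[i]]_4) : 'rV[R]_10 :=
  \row_(k < 10) ip A (nth 0 (Qs (R := R)) k).

Section orthonormal_coordinates.
Local Open Scope complex_scope.
Context {R : realType}.
Local Notation M4 := 'M[R[i]]_4.
Local Notation g := 'rV[R]_10.

Lemma matE (X : g) : mat X = sp2 (phi X). Proof. by rewrite mat.unlock. Qed.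

Lemma QcoordE_row (A : M4) k : Qcoord A 0 k = ip A (nth 0 Qs k).
Proof. by rewrite Qcoord.unlock mxE. Qed.

Lemma sum10 (F : nat -> R) : \sum_(i < 10) F i = F 0 + F 1 + F 2 + F 3 + F 4 + F 5 + F 6 + F 7 + F 8 + F 9.
Proof. by rewrite !big_ord_recr big_ord0 /= add0r. Qed.

Lemma phiE (X : g) l : phi X l = X 0 (inord 0) * Qc 0 l + X 0 (inord 1) * Qc 1 l
  + X 0 (inord 2) * Qc 2 l + X 0 (inord 3) * Qc 3 l + X 0 (inord 4) * Qc 4 l
  + X 0 (inord 5) * Qc 5 l + X 0 (inord 6) * Qc 6 l + X 0 (inord 7) * Qc 7 l
  + X 0 (inord 8) * Qc 8 l + X 0 (inord 9) * Qc 9 l.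
Proof.
rewrite /phi -(sum10 (fun k => X 0 (inord k) * Qc k l)).
by apply: eq_bigr => k _; rewrite inord_val.
Qed.

Lemma phi_lin a (X Y : g) l : phi (a *: X + Y) l = a * phi X l + phi Y l.
Proof.
rewrite /phi mulr_sumr -big_split /=; apply: eq_bigr => k _.
by rewrite !mxE mulrDl mulrA.
Qed.

Lemma mat_lin a (X Y : g) : mat (a *: X + Y) = real_complex R a *: mat X + mat Y.
Proof. by rewrite !matE sp2Z sp2D; apply: sp2_ext => l _; rewrite phi_lin. Qed.

Lemma mat_sum (X : g) : mat X = \sum_(k < 10) real_complex R (X 0 k) *: nth 0 Qs k.
Proof.
have matD (Y Z : g) : mat (Y + Z) = mat Y + mat Z.
  by have := mat_lin 1 Y Z; rewrite rmorph1 !scale1r.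
have mat0 : mat (0 : g) = 0 by apply: (addrI (mat 0)); rewrite -matD !addr0.
rewrite {1}[X]row_sum_delta; apply: (big_ind2 (fun a b => mat a = b)) => //.
  by move=> y1 z1 y2 z2 <- <-.
move=> k _; rewrite -[X in mat X]addr0 mat_lin mat0 addr0 Qs_sp2 //.
congr (_ *: _); rewrite matE; apply: sp2_ext => l _; rewrite /phi (bigD1 k) //= mxE !eqxx mul1r big1 ?addr0 //.
by move=> i ik; rewrite mxE (negbTE ik) andbF mul0r.
Qed.

Lemma ip_linl (a : R) (A B C : M4) : ip (real_complex R a *: A + B) C = a * ip A C + ip B C.
Proof.
rewrite /ip mulmxDl -scalemxAl mxtraceD mxtraceZ cReD cReM /=; ring.
Qed.

Lemma Qcoord_lin (a : R) (A B : M4) : Qcoord (real_complex R a *: A + B) = a *: Qcoord A + Qcoord B.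
Proof. by apply/rowP => k; rewrite [RHS]mxE [X in _ = X + _]mxE !QcoordE_row ip_linl. Qed.

Lemma QcoordE (s : nat -> R) k : (k < 10)%N -> Qcoord (sp2 s) 0 (inord k) = sp2_ip s (Qc k).
Proof. by move=> k10; rewrite QcoordE_row inordK // Qs_sp2 // ip_sp2. Qed.

Lemma row10P (X Y : g) : (forall k, (k < 10)%N -> X 0 (inord k) = Y 0 (inord k)) -> X = Y.
Proof. by move=> H; apply/rowP => k; rewrite -(inord_val k); exact: H. Qed.

Lemma QcoordK (s : nat -> R) : mat (Qcoord (sp2 s)) = sp2 s.
Proof.
rewrite matE; apply: sp2_ext => l l10; rewrite phiE !QcoordE // /sp2_ip.
(* From here on the roots are variables with known squares. *)
rewrite /Qc; move: (Num.sqrt 2) (Num.sqrt 3) (Num.sqrt 5) (@sq2 R) (@sq3 R) (@sq5 R) => b2 b3 b5 e2 e3 e5.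
do 10?[case: l l10 => [_|l l10]; first by rewrite /=; field: e2 e3 e5].
by [].
Qed.

Lemma matK (X : g) : Qcoord (mat X) = X.
Proof.
apply: row10P => k k10; rewrite matE QcoordE // /sp2_ip !phiE.
(* From here on the roots are variables with known squares. *)
rewrite /Qc; move: (Num.sqrt 2) (Num.sqrt 3) (Num.sqrt 5) (@sq2 R) (@sq3 R) (@sq5 R) => b2 b3 b5 e2 e3 e5.
do 10?[case: k k10 => [_|k k10]; first by rewrite /=; field: e2 e3 e5].
by [].
Qed.
End orthonormal_coordinates.

(** * The naturally reductive decomposition of sp(2) *)

Lemma mx_jacobi (K : comPzRingType) n (A B C : 'M[K]_n) :
  (A *m B - B *m A) *m C - C *m (A *m B - B *m A) =
  (A *m (B *m C - C *m B) - (B *m C - C *m B) *m A)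
  - (B *m (A *m C - C *m A) - (A *m C - C *m A) *m B).
Proof.
rewrite !(mulmxBl, mulmxBr) !mulmxA; do !move: (_ *m _ *m _) => ?.
by apply/matrixP => i j; rewrite !mxE; ring.
Qed.

Lemma mx_trace_invariant (K : comPzRingType) n (A B C : 'M[K]_n) :
  \tr ((A *m B - B *m A) *m C) = \tr (A *m (B *m C - C *m B)).
Proof.
rewrite mulmxBl mulmxBr !raddfB /= -!mulmxA; congr (_ - _).
by rewrite mxtrace_mulC mulmxA.
Qed.

HB.lock Definition brk (R : realType) (X Y : 'rV[R]_10) : 'rV[R]_10 :=
  Qcoord (mat X *m mat Y - mat Y *m mat X).

Section sp2_algebra.
Local Open Scope complex_scope.
Context {R : realType}.
Local Notation M4 := 'M[R[i]]_4.
Local Notation g := 'rV[R]_10.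
Local Notation a2 := (Num.sqrt 2 : R).
Local Notation a3 := (Num.sqrt 3 : R).
Local Notation a5 := (Num.sqrt 5 : R).

Definition pm7 (X : g) : g := \row_k (if (k < 7)%N then X 0 k else 0).

Lemma brk_def (X Y : g) : brk X Y = Qcoord (mat X *m mat Y - mat Y *m mat X).
Proof. by rewrite brk.unlock. Qed.

Lemma mat_brk (X Y : g) : mat (brk X Y) = mat X *m mat Y - mat Y *m mat X.
Proof. by rewrite brk_def !matE sp2_commutator -matE QcoordK. Qed.

Lemma QcoordB (A B : M4) : Qcoord (A - B) = Qcoord A - Qcoord B.
Proof.
have := Qcoord_lin (-1) B A; rewrite rmorphN1 !scaleN1r addrC => ->.
by rewrite addrC.
Qed.

Lemma QcoordN (A : M4) : Qcoord (- A) = - Qcoord A.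
Proof.
have Q0 : Qcoord (0 : M4) = 0 by rewrite -(subrr 0) QcoordB subrr.
by rewrite -[- A]sub0r QcoordB Q0 sub0r.
Qed.

Lemma ipC (A B : M4) : ip A B = ip B A.
Proof. by rewrite /ip mxtrace_mulC. Qed.

Lemma ip_mat (A : M4) (Y : g) : ip A (mat Y) = dot (Qcoord A) Y.
Proof.
rewrite mat_sum ipC /dot.
have ip0 : ip 0 A = 0 by rewrite /ip mul0mx mxtrace0 mulr0.
have ipD (B C : M4) : ip (B + C) A = ip B A + ip C A.
  by have := ip_linl 1 B C A; rewrite rmorph1 scale1r mul1r.
rewrite (big_morph (fun B => ip B A) ipD ip0); apply: eq_bigr => k _.
have := ip_linl (Y 0 k) (nth 0 Qs k) 0 A; rewrite addr0 ip0 addr0 => ->.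
by rewrite mulrC QcoordE_row ipC.
Qed.

Lemma ip_mat_mat (X Y : g) : ip (mat X) (mat Y) = dot X Y.
Proof. by rewrite ip_mat matK. Qed.

Lemma brk_linl a (x y z : g) : brk (a *: x + y) z = a *: brk x z + brk y z.
Proof.
rewrite !brk_def -Qcoord_lin mat_lin mulmxDl mulmxDr -scalemxAl -scalemxAr; congr Qcoord.
by rewrite scalerBr opprD addrACA.
Qed.

Lemma brk_anti (x y : g) : brk x y = - brk y x.
Proof. by rewrite !brk_def -QcoordN opprB. Qed.

Lemma brk_jacobi (x y z : g) : brk (brk x y) z = brk x (brk y z) - brk y (brk x z).
Proof.
rewrite (brk_def (brk x y)) (brk_def x (brk y z)) (brk_def y (brk x z)) (mat_brk x y) (mat_brk y z) (mat_brk x z).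
by rewrite -QcoordB mx_jacobi.
Qed.

Lemma brk_dot (x y z : g) : dot (brk x y) z = dot x (brk y z).
Proof.
rewrite -(ip_mat_mat (brk x y)) -(ip_mat_mat x) (mat_brk x y) (mat_brk y z).
by rewrite /ip mx_trace_invariant.
Qed.

Lemma pm7_lin a x y : pm7 (a *: x + y) = a *: pm7 x + pm7 y.
Proof. by apply/rowP => k; rewrite !mxE; case: ifP => // _; rewrite mulr0 addr0. Qed.

Lemma pm7_idem x : pm7 (pm7 x) = pm7 x.
Proof. by apply/rowP => k; rewrite !mxE; case: ltnP => _; rewrite ?mulr0 ?addr0 ?mxE. Qed.

Lemma pm7_dot x y : dot (pm7 x) y = dot x (pm7 y).
Proof. by apply: eq_bigr => k _; rewrite !mxE; case: ifP; rewrite ?mulr0 ?mul0r. Qed.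

Lemma brkE (x y : g) k : (k < 10)%N -> brk x y 0 (inord k) = sp2_ip (sp2_br (phi x) (phi y)) (Qc k).
Proof. by move=> k10; rewrite brk_def !matE sp2_commutator QcoordE. Qed.

Lemma sp2_br_ext s s' t t' k : (k < 10)%N -> (forall l, (l < 10)%N -> s l = s' l) ->
  (forall l, (l < 10)%N -> t l = t' l) -> @sp2_br R s t k = sp2_br s' t' k.
Proof.
move=> k10 Hs Ht; rewrite /sp2_br !Hs // !Ht //.
Qed.

(** Elements of h and of m in the basis S1, ..., S10. *)
Definition hcoef (x y z : R) : nat -> R := nth 0
  [:: 3 / 2 * x; 1 / 2 * x; 0; 0; y; z; a3 / 2 * y; a3 / 2 * z; 0; 0].

Definition mcoef (x : nat -> R) : nat -> R := nth 0
  [:: 1 / 2 * x 0; - (3 / 2) * x 0; a5 * a2 / 2 * x 1; a5 * a2 / 2 * x 2;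
      a2 * a3 / 2 * x 3; a2 * a3 / 2 * x 4; - (a2 / 2) * x 3; - (a2 / 2) * x 4;
      a5 / 2 * x 5; a5 / 2 * x 6].

Lemma phi_h (x : g) l : (l < 10)%N -> (forall k, (k < 7)%N -> x 0 (inord k) = 0) ->
  phi x l = hcoef (x 0 (inord 7)) (x 0 (inord 8)) (x 0 (inord 9)) l.
Proof.
move=> l10 H; rewrite phiE (H 0%N) // (H 1%N) // (H 2%N) // (H 3%N) // (H 4%N) // (H 5%N) // (H 6%N) //.
rewrite /hcoef /Qc.
move: (x 0 (inord 7)) (x 0 (inord 8)) (x 0 (inord 9)) a2 a3 a5 => y7 y8 y9 b2 b3 b5.
do 10?[case: l l10 => [_|l l10]; first by rewrite /=; ring].
by [].
Qed.

Lemma phi_m (x : g) l : (l < 10)%N -> (forall k, (7 <= k < 10)%N -> x 0 (inord k) = 0) ->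
  phi x l = mcoef (fun k => x 0 (inord k)) l.
Proof.
move=> l10 H; rewrite phiE (H 7%N) // (H 8%N) // (H 9%N) // /mcoef /Qc.
do 10?[case: l l10 => [_|l l10]; first by rewrite /=; ring].
by [].
Qed.

Lemma brk_hh (x y : g) : pm7 (brk (x - pm7 x) (y - pm7 y)) = 0.
Proof.
apply: row10P => k k10; rewrite [LHS]mxE [RHS]mxE inordK //; case: ifP => // k7.
have H (z : g) j : (j < 7)%N -> (z - pm7 z) 0 (inord j) = 0.
  by move=> j7; rewrite !mxE inordK ?j7 ?subrr // (ltn_trans j7).
rewrite brkE // /sp2_ip.
have E l : (l < 10)%N -> sp2_br (phi (x - pm7 x)) (phi (y - pm7 y)) l = sp2_br
   (hcoef ((x - pm7 x) 0 (inord 7)) ((x - pm7 x) 0 (inord 8)) ((x - pm7 x) 0 (inord 9)))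
   (hcoef ((y - pm7 y) 0 (inord 7)) ((y - pm7 y) 0 (inord 8)) ((y - pm7 y) 0 (inord 9))) l.
  by move=> l10; apply: sp2_br_ext => // j j10; apply: phi_h => // i; exact: H.
rewrite !E // /hcoef /Qc.
move: ((x - pm7 x) 0 (inord 7)) ((x - pm7 x) 0 (inord 8)) ((x - pm7 x) 0 (inord 9)) => x7 x8 x9.
move: ((y - pm7 y) 0 (inord 7)) ((y - pm7 y) 0 (inord 8)) ((y - pm7 y) 0 (inord 9)) => y7 y8 y9.
move: (Num.sqrt 2) (Num.sqrt 3) (Num.sqrt 5) (@sq2 R) (@sq3 R) (@sq5 R) => b2 b3 b5 e2 e3 e5.
clear k10; do 7?[case: k k7 => [_|k k7]; first by rewrite /sp2_br /=; field: e2 e3 e5].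
by [].
Qed.

Lemma brk_naturally_reductive : naturally_reductive (@brk R) pm7.
Proof.
exact: (NaturallyReductive brk_linl brk_anti brk_jacobi brk_dot pm7_lin pm7_idem pm7_dot brk_hh).
Qed.

(** The cross product of R^7: each of the seven triples of indices that occur
    contributes a term to three components. *)
Definition crossc (a x : nat -> R) : nat -> R :=
  let w i j := a i * x j - a j * x i in nth 0
  [:: w 1 2 - w 3 4 - w 5 6;
      - w 0 2 + w 3 5 - w 4 6;
      w 0 1 + w 3 6 + w 4 5;
      w 0 4 - w 1 5 - w 2 6;
      - w 0 3 + w 1 6 - w 2 5;
      w 0 6 + w 1 3 + w 2 4;
      - w 0 5 - w 1 4 + w 2 3].

Lemma pm7_tail (x : g) : pm7 x = x -> forall k, (7 <= k < 10)%N -> x 0 (inord k) = 0.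
Proof. by move=> <- k /andP[k7 k10]; rewrite mxE inordK // ltnNge k7. Qed.

(** The factor -1/5 in the scalar product makes all the structure constants of
    [., .]_m in the basis Q1, ..., Q7 equal to 0, 1 or -1. *)
Lemma mcoef_br (a x : nat -> R) k : (k < 7)%N ->
  sp2_ip (sp2_br (mcoef a) (mcoef x)) (Qc k) = crossc a x k.
Proof.
rewrite /sp2_ip /mcoef /Qc.
move: (Num.sqrt 2) (Num.sqrt 3) (Num.sqrt 5) (@sq2 R) (@sq3 R) (@sq5 R) => b2 b3 b5 e2 e3 e5.
do 7?[case: k => [_|k]; first by rewrite /sp2_br /crossc /=; field: e2 e3 e5].
by [].
Qed.

Lemma mbE (a x : g) k : pm7 a = a -> pm7 x = x -> (k < 7)%N ->
  mb (@brk R) pm7 a x 0 (inord k) = crossc (fun j => a 0 (inord j)) (fun j => x 0 (inord j)) k.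
Proof.
move=> /pm7_tail ma /pm7_tail mx k7; have k10 : (k < 10)%N by exact: ltn_trans k7 _.
rewrite mxE inordK // k7 brkE // -mcoef_br // /sp2_ip.
have E l : (l < 10)%N -> sp2_br (phi a) (phi x) l = sp2_br
   (mcoef (fun j => a 0 (inord j))) (mcoef (fun j => x 0 (inord j))) l.
  by move=> l10; apply: sp2_br_ext => // j j10; exact: phi_m.
by rewrite !E.
Qed.

Lemma dot_pm7 (a x : g) : pm7 a = a -> dot a x = a 0 (inord 0) * x 0 (inord 0)
  + a 0 (inord 1) * x 0 (inord 1) + a 0 (inord 2) * x 0 (inord 2)
  + a 0 (inord 3) * x 0 (inord 3) + a 0 (inord 4) * x 0 (inord 4)
  + a 0 (inord 5) * x 0 (inord 5) + a 0 (inord 6) * x 0 (inord 6).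
Proof.
move=> /pm7_tail ma.
apply: (etrans _ (etrans (sum10 (fun k : nat => a 0 (inord k) * x 0 (inord k))) _)).
  by apply: eq_bigr => k _; rewrite inord_val.
by rewrite (ma 7%N) // (ma 8%N) // (ma 9%N) // !mul0r !addr0.
Qed.

Lemma pm7_cross (a x : g) : pm7 a = a -> pm7 x = x ->
  mb (@brk R) pm7 a (mb (@brk R) pm7 a x) = dot a x *: a - dot a a *: x.
Proof.
move=> ma mx; apply: row10P => k k10.
have [k7|k7] := ltnP k 7; last first.
  rewrite mxE inordK // ltnNge k7 /= !mxE !pm7_tail ?k7 //; ring.
have mm := pm_mb brk_naturally_reductive a x.
rewrite mbE // !mxE !dot_pm7 //.
rewrite /crossc /=.
rewrite !mbE // /crossc /=.
clear k10; do 7?[case: k k7 => [_|k k7]; first by rewrite /=; ring].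
by [].
Qed.
End sp2_algebra.

(** * Derivatives of complex matrix valued maps *)

Section complex_calculus.
Local Open Scope complex_scope.
Context {R : realType} {T : normedModType R}.
Local Notation Mx := 'M[R[i]]_4.

(** Derivatives in real directions of complex valued maps, taken separately on
    real and imaginary parts. *)
Definition is_cderive (f : T -> R[i]) (x v : T) (d : R[i]) : Prop :=
  is_derive x v (fun y => complex.Re (f y)) (complex.Re d) /\
  is_derive x v (fun y => complex.Im (f y)) (complex.Im d).

Definition is_mderive (f : T -> Mx) (x v : T) (D : Mx) : Prop :=
  forall i j, is_cderive (fun y => f y i j) x v (D i j).

Lemma is_cderive_eqf f h x v d : (forall y, f y = h y) -> is_cderive f x v d -> is_cderive h x v d.
Proof. by move=> E; have -> : h = f by apply/funext => y; rewrite E. Qed.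

Lemma is_cderive_mul f h x v df dh : is_cderive f x v df -> is_cderive h x v dh ->
  is_cderive (fun y => f y * h y) x v (df * h x + f x * dh).
Proof.
move=> [Rf If] [Rh Ih]; split.
  have -> : (fun y => complex.Re (f y * h y)) = (fun y => complex.Re (f y) * complex.Re (h y) - complex.Im (f y) * complex.Im (h y)).
    by apply/funext => y; rewrite cReM.
  apply: (is_derive_eq (is_deriveB (is_derive_mulr Rf Rh) (is_derive_mulr If Ih))).
  rewrite !cE; ring.
have -> : (fun y => complex.Im (f y * h y)) = (fun y => complex.Re (f y) * complex.Im (h y) + complex.Im (f y) * complex.Re (h y)).
  by apply/funext => y; rewrite cImM.
apply: (is_derive_eq (is_deriveD (is_derive_mulr Rf Ih) (is_derive_mulr If Rh))).
rewrite !cE; ring.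
Qed.

Lemma cRe_sum m (F : 'I_m -> R[i]) : complex.Re (\sum_i F i) = \sum_i complex.Re (F i).
Proof. by apply: (big_morph (@complex.Re R)) => // a b; rewrite cReD. Qed.
Lemma cIm_sum m (F : 'I_m -> R[i]) : complex.Im (\sum_i F i) = \sum_i complex.Im (F i).
Proof. by apply: (big_morph (@complex.Im R)) => // a b; rewrite cImD. Qed.

Lemma is_cderive_sum m (F : 'I_m -> T -> R[i]) x v dF :
  (forall i, is_cderive (F i) x v (dF i)) ->
  is_cderive (fun y => \sum_i F i y) x v (\sum_i dF i).
Proof.
move=> H; split.
  under eq_fun do rewrite cRe_sum; rewrite cRe_sum.
  by apply: is_derive_sumE => i; have [] := H i.
under eq_fun do rewrite cIm_sum; rewrite cIm_sum.
by apply: is_derive_sumE => i; have [] := H i.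
Qed.

Lemma is_cderive_conj f x v d : is_cderive f x v d ->
  is_cderive (fun y => Num.conj (f y)) x v (Num.conj d).
Proof.
have cR (z : R[i]) : complex.Re (Num.conj z) = complex.Re z by case: z.
have cI (z : R[i]) : complex.Im (Num.conj z) = - complex.Im z by case: z.
move=> [Rf If]; split.
  by under eq_fun do rewrite cR; rewrite cR.
under eq_fun do rewrite cI; rewrite cI; exact: is_deriveN.
Qed.

Lemma is_cderive_cst (a : R[i]) x v : is_cderive (fun=> a) x v 0.
Proof. by split; exact: is_derive_cst. Qed.

Lemma is_cderive_unique f x v a b : is_cderive f x v a -> is_cderive f x v b -> a = b.
Proof.
move=> [Ra Ia] [Rb Ib]; apply: complex_ext.
  exact: is_derive_unique Ra Rb.
exact: is_derive_unique Ia Ib.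
Qed.

Lemma is_cderive_near f h x v d : (\near x, f x = h x) -> is_cderive h x v d -> is_cderive f x v d.
Proof.
move=> E [Rh Ih]; split.
  by apply: is_derive_near Rh; apply: filterS E => y ->.
by apply: is_derive_near Ih; apply: filterS E => y ->.
Qed.

Lemma is_mderive_mul f h x v Df Dh : is_mderive f x v Df -> is_mderive h x v Dh ->
  is_mderive (fun y => f y *m h y) x v (Df *m h x + f x *m Dh).
Proof.
move=> Hf Hh i j.
have E y : (f y *m h y) i j = \sum_k f y i k * h y k j by rewrite mxE.
apply: (is_cderive_eqf (fun y => esym (E y))).
have -> : (Df *m h x + f x *m Dh) i j = \sum_k (Df i k * h x k j + f x i k * Dh k j).
  by rewrite mxDE big_split /= ![(_ *m _) _ _]mxE.
by apply: is_cderive_sum => k; exact: is_cderive_mul.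
Qed.

Lemma is_mderive_tr f x v D : is_mderive f x v D -> is_mderive (fun y => (f y)^T) x v D^T.
Proof.
move=> Hf i j; rewrite mxE.
by apply: (is_cderive_eqf (f := fun y => f y j i)) => // y; rewrite mxE.
Qed.

Lemma is_mderive_tconj f x v D : is_mderive f x v D ->
  is_mderive (fun y => ((f y)^t*)%sesqui) x v ((D^t*)%sesqui).
Proof.
move=> Hf i j; rewrite mxE mxE.
apply: (is_cderive_eqf (f := fun y => Num.conj (f y j i))); first by move=> y; rewrite !mxE.
exact: is_cderive_conj.
Qed.

Lemma is_mderive_cst (A : Mx) x v : is_mderive (fun=> A) x v 0.
Proof. by move=> i j; rewrite mxE; exact: is_cderive_cst. Qed.

Lemma is_mderive_unique f x v A B : is_mderive f x v A -> is_mderive f x v B -> A = B.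
Proof. by move=> HA HB; apply/matrixP => i j; exact: is_cderive_unique (HA i j) (HB i j). Qed.

Lemma is_mderive_near f h x v D : (\near x, f x = h x) -> is_mderive h x v D -> is_mderive f x v D.
Proof.
by move=> E Hh i j; apply: is_cderive_near (Hh i j); apply: filterS E => y ->.
Qed.

Lemma is_derive_Qcoord f x v D : is_mderive f x v D ->
  is_derive x v (fun y => Qcoord (f y)) (Qcoord D).
Proof.
move=> Hf; apply/is_derive_rowP => k.
have E y : Qcoord (f y) 0 k = complex.Re (\tr (f y *m nth 0 (Qs (R := R)) k)) * - (1 / 5).
  by rewrite QcoordE_row mulrC.
have [H _] : is_cderive (fun y => \tr (f y *m nth 0 (Qs (R := R)) k)) x v (\tr (D *m nth 0 (Qs (R := R)) k)).
  apply: is_cderive_sum => i.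
  have := is_mderive_mul Hf (is_mderive_cst (nth 0 (Qs (R := R)) k) x v) i i.
  by rewrite mulmx0 addr0.
under eq_fun do rewrite E.
apply: (is_derive_eq (is_derive_cstmul (- (1 / 5)) H)).
by rewrite QcoordE_row mulrC.
Qed.
End complex_calculus.

Section complex_smooth.
Local Open Scope complex_scope.
Context {R : realType} {V : normedModType R}.
Variable U : set V.
Hypothesis oU : open U.

Definition csmooth (f : V -> R[i]) : Prop :=
  smooth_on U (fun y => complex.Re (f y)) /\ smooth_on U (fun y => complex.Im (f y)).

Lemma smooth_on_eqf (f h : V -> R) : (forall y, f y = h y) -> smooth_on U f -> smooth_on U h.
Proof. by move=> E; have -> : h = f by apply/funext => y; rewrite E. Qed.

Lemma smooth_on_opp (f : V -> R) : smooth_on U f -> smooth_on U (fun y => - f y).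
Proof.
move=> fs; apply: (smooth_on_eqf (f := fun y => (-1) * f y)); first by move=> y; rewrite mulN1r.
apply: smooth_on_mul => //; exact: smooth_on_cst.
Qed.

Lemma csmooth_mul f h : csmooth f -> csmooth h -> csmooth (fun y => f y * h y).
Proof.
move=> [Rf If] [Rh Ih]; split.
  apply: (smooth_on_eqf (fun y => esym (cReM _ _))).
  by apply: smooth_on_add => //; [|apply: smooth_on_opp]; exact: smooth_on_mul.
apply: (smooth_on_eqf (fun y => esym (cImM _ _))).
by apply: smooth_on_add => //; exact: smooth_on_mul.
Qed.

Lemma csmooth_sum m (F : 'I_m -> V -> R[i]) : (forall i, csmooth (F i)) ->
  csmooth (fun y => \sum_i F i y).
Proof.
move=> H; split.
  apply: (smooth_on_eqf (fun y => esym (cRe_sum _))).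
  by apply: smooth_on_sum => // i; have [] := H i.
apply: (smooth_on_eqf (fun y => esym (cIm_sum _))).
by apply: smooth_on_sum => // i; have [] := H i.
Qed.

Lemma csmooth_conj f : csmooth f -> csmooth (fun y => Num.conj (f y)).
Proof.
move=> [Rf If]; split.
  by apply: (smooth_on_eqf _ Rf) => y; case: (f y).
by apply: (smooth_on_eqf _ (smooth_on_opp If)) => y; case: (f y).
Qed.

Lemma csmooth_cst a : csmooth (fun=> a).
Proof. by split; exact: smooth_on_cst. Qed.
End complex_smooth.

(** * The Maurer-Cartan form of a chart of V_1 *)

Lemma symplectic_derivative (K : comPzRingType) n (S D M J : 'M[K]_n) :
  D = S *m M -> S^T *m J *m S = J ->
  (D^T *m J + S^T *m 0) *m S + S^T *m J *m D = 0 -> M^T *m J + J *m M = 0.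
Proof.
move=> -> E <-; rewrite mulmx0 addr0 trmx_mul -!mulmxA (mulmxA J S M).
by rewrite (mulmxA S^T (J *m S)) (mulmxA S^T J) E.
Qed.

Lemma mulmx_cancel_mid (K : comPzRingType) n (S Sc M Mc N : 'M[K]_n) :
  Sc *m S = 1%:M -> Mc = - M -> Mc *m Sc *m (S *m N) = - (M *m N).
Proof. by move=> E ->; rewrite -mulmxA (mulmxA Sc) E mul1mx mulNmx. Qed.

Lemma sub_cancel_mid (Z : zmodType) (a b s : Z) : - a + s - (- b + s) = - (a - b).
Proof. by rewrite opprD addrACA subrr addr0 opprB opprK addrC. Qed.

Section sp2_membership.
Local Open Scope complex_scope.
Context {R : realType}.
Local Notation M4 := 'M[R[i]]_4.

Definition sp2_entries (A : M4) : nat -> R := nth 0 [::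
  complex.Im (A (inord 0) (inord 0)); complex.Im (A (inord 2) (inord 2));
  complex.Re (A (inord 0) (inord 1)); complex.Im (A (inord 0) (inord 1));
  complex.Re (A (inord 2) (inord 3)); complex.Im (A (inord 2) (inord 3));
  complex.Re (A (inord 0) (inord 2)); complex.Im (A (inord 0) (inord 2));
  complex.Re (A (inord 0) (inord 3)); complex.Im (A (inord 0) (inord 3))].

Lemma sp2_entry_real (a b : nat -> nat -> R) i j : (i < 4)%N -> (j < 4)%N ->
  (forall i j, a j i = - a i j) -> (forall i j, b j i = b i j) ->
  a 0 0 + a 1 1 = 0 -> b 0 0 + b 1 1 = 0 -> a 3 0 + a 1 2 = 0 -> b 3 0 + b 1 2 = 0 ->
  - a 2 0 + a 1 3 = 0 -> - b 2 0 + b 1 3 = 0 -> a 3 1 - a 0 2 = 0 -> b 3 1 - b 0 2 = 0 ->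
  - a 2 1 - a 0 3 = 0 -> - b 2 1 - b 0 3 = 0 -> - a 2 2 - a 3 3 = 0 -> - b 2 2 - b 3 3 = 0 ->
  let s := nth 0 [:: b 0 0; b 2 2; a 0 1; b 0 1; a 2 3; b 2 3; a 0 2; b 0 2; a 0 3; b 0 3] in
  a i j = complex.Re (sp2_entry s i j) /\ b i j = complex.Im (sp2_entry s i j).
Proof.
move=> i4 j4 aN bC a0 b0 a1 b1 a2 b2 a3 b3 a4 b4 a5 b5.
move: i j i4 j4; case4; case4 => _ _; rewrite /sp2_entry /=; split;
  move: (aN 0 0) (aN 0 1) (aN 0 2) (aN 0 3) (aN 1 1) (aN 1 2) (aN 1 3) (aN 2 2) (aN 2 3) (aN 3 3)
    (bC 0 1) (bC 0 2) (bC 0 3) (bC 1 2) (bC 1 3) (bC 2 3); lra.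
Qed.

Lemma Jsp_entry i j : (i < 4)%N -> (j < 4)%N ->
  Jsp R (inord i) (inord j) =
  ((i == 0) && (j == 1))%:R - ((i == 1) && (j == 0))%:R
  - ((i == 2) && (j == 3))%:R + ((i == 3) && (j == 2))%:R.
Proof. by move=> i4 j4; rewrite /Jsp !(mxDE, mxNE) !E_entry. Qed.

(** In each of the four 2 x 2 blocks of A the two conditions together determine the
    second row from the first one. *)
Lemma sp2_of_skew_symplectic (A : M4) :
  ((A^t*)%sesqui = - A) -> A^T *m Jsp R + Jsp R *m A = 0 -> A = sp2 (sp2_entries A).
Proof.
move=> hS hJ.
have S i j : Num.conj (A j i) = - A i j.
  by have /matrixP/(_ i j) := hS; rewrite mxNE => <-; rewrite !mxE.
have SR i j : complex.Re (A j i) = - complex.Re (A i j).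
  by rewrite -cReN -S; case: (A j i).
have SI i j : complex.Im (A j i) = complex.Im (A i j).
  by have := congr1 (@complex.Im R) (S i j); rewrite cImN; case: (A j i) => a b /= /oppr_inj.
have J i j : (i < 4)%N -> (j < 4)%N ->
   \sum_k A k (inord i) * Jsp R k (inord j) + \sum_k Jsp R (inord i) k * A k (inord j) = 0.
  move=> i4 j4; have /matrixP/(_ (inord i) (inord j)) := hJ.
  rewrite mxDE [(A^T *m _) _ _]mxE [(_ *m A) _ _]mxE [RHS]mxE => Eij; rewrite -[RHS]Eij.
  by congr (_ + _); apply: eq_bigr => k _; rewrite [A^T _ _]mxE.
have J01 := J 0%N 1%N isT isT; have J02 := J 0%N 2%N isT isT; have J03 := J 0%N 3%N isT isT.
have J12 := J 1%N 2%N isT isT; have J13 := J 1%N 3%N isT isT; have J23 := J 2%N 3%N isT isT.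
clear J.
move: J01 J02 J03 J12 J13 J23; rewrite !sum4 !Jsp_entry //=.
rewrite ?(subr0, sub0r, addr0, add0r, mulr0, mul0r, mulr1, mul1r, mulrN1, mulN1r).
move=> E0 E1 E2 E3 E4 E5.
have P (z : R[i]) : z = 0 -> complex.Re z = 0 /\ complex.Im z = 0 by move=> ->.
move: (P _ E0) (P _ E1) (P _ E2) (P _ E3) (P _ E4) (P _ E5); rewrite !cE => {E0 E1 E2 E3 E4 E5 S hS hJ P}.
move=> [a0 b0] [a1 b1] [a2 b2] [a3 b3] [a4 b4] [a5 b5].
apply: sp2P => i j i4 j4.
pose a i j := complex.Re (A (inord i) (inord j)); pose b i j := complex.Im (A (inord i) (inord j)).
have aN i' j' : a j' i' = - a i' j' by exact: SR.
have bC i' j' : b j' i' = b i' j' by exact: SI.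
have [eR eI] := sp2_entry_real i4 j4 aN bC a0 b0 a1 b1 a2 b2 a3 b3 a4 b4 a5 b5.
exact: complex_ext.
Qed.
End sp2_membership.

Section chart_frame.
Local Open Scope complex_scope.
Context {R : realType}.
Local Notation M4 := 'M[R[i]]_4.
Local Notation V := 'rV[R]_7.
Local Notation g := 'rV[R]_10.
Variables (U : set V) (sigma : V -> M4).
Hypothesis hchart : is_chart U sigma.

Let oU : open U. Proof. by case: hchart. Qed.

Definition om (x u : V) : g := Qcoord (invmx (sigma x) *m diff_mx sigma x u).

Lemma sigma_csmooth i j : csmooth U (fun y => sigma y i j).
Proof.
case: hchart => _ [sR sI] _ _ _; split.
  apply: (smooth_on_eqf _ (smooth_on_coord i j oU sR)) => y; by rewrite mxE.
by apply: (smooth_on_eqf _ (smooth_on_coord i j oU sI)) => y; rewrite mxE.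
Qed.

Lemma diff_mx_parts x u i j : U x ->
  complex.Re (diff_mx sigma x u i j) = 'D_u (fun y => complex.Re (sigma y i j)) x /\
  complex.Im (diff_mx sigma x u i j) = 'D_u (fun y => complex.Im (sigma y i j)) x.
Proof.
move=> Ux; case: hchart => _ [sR sI] _ _ _.
rewrite /diff_mx mxDE mxZE ![map_mx _ _ _ _]mxE.
rewrite (derive_mx (smooth_on_derivable sR Ux)) (derive_mx (smooth_on_derivable sI Ux)).
rewrite ![(\matrix_(_, _) _) _ _]mxE.
have -> : (fun y => map_mx (@complex.Re R) (sigma y) i j) = (fun y => complex.Re (sigma y i j)).
  by apply/funext => y; rewrite mxE.
have -> : (fun y => map_mx (@complex.Im R) (sigma y) i j) = (fun y => complex.Im (sigma y i j)).
  by apply/funext => y; rewrite mxE.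
move: ('D_u _ x) ('D_u _ x) => a b.
by rewrite !cE /=; split; ring.
Qed.

Lemma is_mderive_sigma x u : U x -> is_mderive sigma x u (diff_mx sigma x u).
Proof.
move=> Ux i j; have [sR sI] := sigma_csmooth i j; have [dR dI] := diff_mx_parts u i j Ux.
split; [rewrite dR | rewrite dI]; apply/derivableP.
  exact (smooth_on_derivable sR Ux).
exact (smooth_on_derivable sI Ux).
Qed.

Lemma csmooth_eq_on (f h : V -> R[i]) : (forall y, U y -> f y = h y) -> csmooth U f -> csmooth U h.
Proof.
move=> E [fR fI]; split.
  by apply: smooth_on_ext fR => // y Uy; rewrite E.
by apply: smooth_on_ext fI => // y Uy; rewrite E.
Qed.

Lemma diff_mx_csmooth v i j : csmooth U (fun y => diff_mx sigma y v i j).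
Proof.
have [sR sI] := sigma_csmooth i j; split.
  apply: (smooth_on_ext oU _ (smooth_on_derive v sR)) => y Uy.
  by have [-> _] := diff_mx_parts v i j Uy.
apply: (smooth_on_ext oU _ (smooth_on_derive v sI)) => y Uy.
by have [_ ->] := diff_mx_parts v i j Uy.
Qed.

Definition diff2_mx x u v : M4 := \matrix_(i, j)
  ('D_u (fun y => 'D_v (fun z => complex.Re (sigma z i j)) y) x +i*
   'D_u (fun y => 'D_v (fun z => complex.Im (sigma z i j)) y) x).

Lemma diff2_mx_sym x u v : U x -> diff2_mx x u v = diff2_mx x v u.
Proof.
move=> Ux; apply/matrixP => i j; have [sR sI] := sigma_csmooth i j.
by rewrite [LHS]mxE [RHS]mxE (schwarz u v oU (sR 2%N) Ux) (schwarz u v oU (sI 2%N) Ux).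
Qed.

Lemma is_mderive_diff x u v : U x ->
  is_mderive (fun y => diff_mx sigma y v) x u (diff2_mx x u v).
Proof.
move=> Ux i j; have [sR sI] := sigma_csmooth i j; rewrite mxE; split => /=.
  have E : \near x, complex.Re (diff_mx sigma x v i j) = 'D_v (fun z => complex.Re (sigma z i j)) x.
    by apply: (open_eq_near oU Ux) => y Uy; have [-> _] := diff_mx_parts v i j Uy.
  apply: (is_derive_near E); apply/derivableP.
  exact (smooth_on_derivable (smooth_on_derive v sR) Ux).
have E : \near x, complex.Im (diff_mx sigma x v i j) = 'D_v (fun z => complex.Im (sigma z i j)) x.
  by apply: (open_eq_near oU Ux) => y Uy; have [_ ->] := diff_mx_parts v i j Uy.
apply: (is_derive_near E); apply/derivableP.
exact (smooth_on_derivable (smooth_on_derive v sI) Ux).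
Qed.

Lemma sigma_unitary x : U x -> sigma x \is unitarymx.
Proof. by case: hchart => _ _ H _ _ /H []. Qed.

Lemma sigma_symplectic x : U x -> (sigma x)^T *m Jsp R *m sigma x = Jsp R.
Proof. by case: hchart => _ _ H _ _ /H []. Qed.

Lemma sigma_tconjl x : U x -> ((sigma x)^t*)%sesqui *m sigma x = 1%:M.
Proof. by move=> Ux; apply: mulmx1C; apply/unitarymxP; exact: sigma_unitary. Qed.

Lemma sigma_tconjr x : U x -> sigma x *m ((sigma x)^t*)%sesqui = 1%:M.
Proof. by move=> Ux; apply/unitarymxP; exact: sigma_unitary. Qed.

(** On U, where sigma is unitary, this is sigma^-1 d sigma, without an inverse to
    differentiate. *)
Definition mcform x u : M4 := ((sigma x)^t*)%sesqui *m diff_mx sigma x u.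

Lemma omE x u : U x -> om x u = Qcoord (mcform x u).
Proof. by move=> Ux; rewrite /om invmx_unitary //; exact: sigma_unitary. Qed.

Lemma diff_mcform x u : U x -> diff_mx sigma x u = sigma x *m mcform x u.
Proof. by move=> Ux; rewrite /mcform mulmxA sigma_tconjr // mul1mx. Qed.

Lemma tconj_mul (A B : M4) : ((A *m B)^t*)%sesqui = ((B^t*)%sesqui *m (A^t*)%sesqui).
Proof. by rewrite trmx_mul map_mxM. Qed.

Lemma tconjK (A : M4) : (((A^t*)%sesqui)^t*)%sesqui = A.
Proof. by apply/matrixP => i j; rewrite !mxE conjCK. Qed.

(** Derivative of sigma^* sigma = 1. *)
Lemma mcform_skew x u : U x -> ((mcform x u)^t*)%sesqui = - mcform x u.
Proof.
move=> Ux.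
have D := is_mderive_mul (is_mderive_tconj (is_mderive_sigma u Ux)) (is_mderive_sigma u Ux).
have E : \near x, ((sigma x)^t*)%sesqui *m sigma x = 1%:M.
  by apply: (open_eq_near oU Ux) => y Uy; exact: sigma_tconjl.
have D1 := is_mderive_near E (is_mderive_cst 1%:M x u).
have := is_mderive_unique D D1.
rewrite /mcform tconj_mul tconjK => /eqP; rewrite addr_eq0 => /eqP //.
Qed.

(** Derivative of sigma^T J sigma = J. *)
Lemma mcform_symplectic x u : U x ->
  (mcform x u)^T *m Jsp R + Jsp R *m mcform x u = 0.
Proof.
move=> Ux.
have Ds := is_mderive_sigma u Ux.
have D := is_mderive_mul (is_mderive_mul (is_mderive_tr Ds) (is_mderive_cst (Jsp R) x u)) Ds.
have E : \near x, (sigma x)^T *m Jsp R *m sigma x = Jsp R.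
  by apply: (open_eq_near oU Ux) => y Uy; exact: sigma_symplectic.
have := is_mderive_unique D (is_mderive_near E (is_mderive_cst (Jsp R) x u)).
exact: symplectic_derivative (diff_mcform u Ux) (sigma_symplectic Ux).
Qed.

Lemma mat_om x u : U x -> mat (om x u) = mcform x u.
Proof.
move=> Ux; rewrite omE //.
by rewrite (sp2_of_skew_symplectic (mcform_skew u Ux) (mcform_symplectic u Ux)) QcoordK.
Qed.

Lemma brk_mat (X Y : g) A B : mat X = A -> mat Y = B -> brk X Y = Qcoord (A *m B - B *m A).
Proof. by move=> <- <-; exact: brk_def. Qed.

(** d (sigma^* d sigma) = d sigma^* wedge d sigma since second derivatives are
    symmetric; insert d sigma = sigma omega and use that omega is
    skew-Hermitian. *)
Lemma om_maurer_cartan x u v : U x ->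
  'D_u (fun y => om y v) x - 'D_v (fun y => om y u) x = - brk (om x u) (om x v).
Proof.
move=> Ux.
have D a b : 'D_a (fun y => om y b) x =
    Qcoord (((diff_mx sigma x a)^t*)%sesqui *m diff_mx sigma x b
            + ((sigma x)^t*)%sesqui *m diff2_mx x a b).
  have E : \near x, om x b = Qcoord (mcform x b).
    by apply: (open_eq_near oU Ux) => y Uy; exact: omE.
  have [_ <-] := is_derive_Qcoord (is_mderive_mul (is_mderive_tconj (is_mderive_sigma a Ux)) (is_mderive_diff a b Ux)).
  exact: near_eq_derive E.
have F a b : ((diff_mx sigma x a)^t*)%sesqui *m diff_mx sigma x b = - (mcform x a *m mcform x b).
  rewrite (diff_mcform a Ux) (diff_mcform b Ux) tconj_mul.
  exact: mulmx_cancel_mid (sigma_tconjl Ux) (mcform_skew a Ux).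
have {}D a b : 'D_a (fun y => om y b) x =
    Qcoord (- (mcform x a *m mcform x b) + ((sigma x)^t*)%sesqui *m diff2_mx x a b).
  by rewrite D F.
have Dvu := D v u; rewrite (diff2_mx_sym v u Ux) in Dvu.
apply: (etrans (congr2 (fun X Y => X - Y) (D u v) Dvu)).
have B : brk (om x u) (om x v) = Qcoord (mcform x u *m mcform x v - mcform x v *m mcform x u).
  exact: brk_mat (mat_om u Ux) (mat_om v Ux).
by rewrite B -QcoordB -QcoordN sub_cancel_mid.
Qed.

Lemma pr_m_mat (A : M4) : pr_m A = mat (pm7 (Qcoord A)).
Proof.
pose f (k : nat) : M4 := real_complex R (ip A (nth 0 (Qs (R := R)) k)) *: nth 0 (Qs (R := R)) k.
have -> : pr_m A = \sum_(k < 7) f k.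
  rewrite -(big_mkord xpredT f) /index_iota -[(7 - 0)%N]/7%N.
  have EQ : [:: Q1 R; Q2 R; Q3 R; Q4 R; Q5 R; Q6 R; Q7 R] = map (nth 0 (Qs (R := R))) (iota 0 7) by [].
  by rewrite /pr_m EQ big_map.
rewrite mat_sum (big_ord_widen 10 f) // big_mkcond; apply: eq_bigr => k _.
rewrite /pm7 [(\row__ _) _ _]mxE; case: ifP => _; first by rewrite QcoordE_row.
by rewrite rmorph0 scale0r.
Qed.

Lemma theta_mat x u : theta sigma x u = mat (pm7 (om x u)).
Proof. exact: pr_m_mat. Qed.

Lemma metric_dot : metric sigma = (fun x u v => dot (pm7 (om x u)) (pm7 (om x v))).
Proof.
by apply/funext => x; apply/funext => u; apply/funext => v; rewrite /metric !theta_mat ip_mat_mat.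
Qed.

Lemma om_smooth_coord v k : smooth_on U (fun x => om x v 0 k).
Proof.
have [H _] : csmooth U (fun x => real_complex R (- (1 / 5)) * \tr (mcform x v *m nth 0 (Qs (R := R)) k)).
  apply: csmooth_mul => //; first exact: csmooth_cst.
  rewrite /mxtrace; apply: csmooth_sum => // i.
  apply: (csmooth_eq_on (f := fun y => \sum_l (\sum_m Num.conj (sigma y m i) * diff_mx sigma y v m l) * nth 0 (Qs (R := R)) k l i)).
    move=> y Uy; rewrite [RHS]mxE; apply: eq_bigr => l _; congr (_ * _).
    by rewrite [RHS]mxE; apply: eq_bigr => m _; congr (_ * _); rewrite !mxE.
  apply: csmooth_sum => // l; apply: csmooth_mul => //; last exact: csmooth_cst.
  apply: csmooth_sum => // m; apply: csmooth_mul => //; last exact: diff_mx_csmooth.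
  by apply: csmooth_conj => //; exact: sigma_csmooth.
apply: (smooth_on_ext oU _ H) => y Uy; rewrite omE // QcoordE_row /ip cReM /=.
by rewrite mul0r subr0.
Qed.

Lemma complex_lin (t z w : R[i]) (a : R) :
  complex.Re t = a * complex.Re z + complex.Re w ->
  complex.Im t = a * complex.Im z + complex.Im w -> t = real_complex R a * z + w.
Proof.
by move=> hR hI; apply: complex_ext; rewrite !cE /= mul0r ?subr0 ?addr0.
Qed.

Lemma om_linear x : U x -> forall a u v, om x (a *: u + v) = a *: om x u + om x v.
Proof.
move=> Ux a u v.
have E : diff_mx sigma x (a *: u + v) = real_complex R a *: diff_mx sigma x u + diff_mx sigma x v.
  apply/matrixP => i j; rewrite [RHS]mxDE [X in _ = X + _]mxZE; have [sR sI] := sigma_csmooth i j.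
  have [Ruv Iuv] := diff_mx_parts (a *: u + v) i j Ux.
  have [Ru Iu] := diff_mx_parts u i j Ux; have [Rv Iv] := diff_mx_parts v i j Ux.
  apply: complex_lin.
    apply: (etrans Ruv (etrans (C1_derive_linear a u v oU (sR 1%N) Ux) _)).
    exact: esym (congr2 (fun p q => a * p + q) Ru Rv).
  apply: (etrans Iuv (etrans (C1_derive_linear a u v oU (sI 1%N) Ux) _)).
  exact: esym (congr2 (fun p q => a * p + q) Iu Iv).
by rewrite /om E mulmxDr -scalemxAr Qcoord_lin.
Qed.

Lemma om_injective x : U x -> forall u, pm7 (om x u) = 0 -> u = 0.
Proof.
move=> Ux u E; case: hchart => _ _ _ /(_ x Ux u) + _; apply.
rewrite theta_mat E mat_sum big1 // => k _.
by rewrite mxE rmorph0 scale0r.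
Qed.

Lemma chart_maurer_cartan : maurer_cartan_frame (@brk R) pm7 U om.
Proof.
split=> //.
- exact: om_smooth_coord.
- exact: om_linear.
- by move=> x Ux u v; exact: om_maurer_cartan.
- exact: om_injective.
Qed.
End chart_frame.

(** * Geodesics of V_1 *)

Definition proj7 (R : realType) : 'M[R]_(10, 7) := \matrix_(i, j) ((i : nat) == j)%:R.

Lemma proj7_ker (R : realType) (z : 'rV[R]_10) : z *m proj7 R = 0 <-> pm7 z = 0.
Proof.
have E (j : 'I_7) : (z *m proj7 R) 0 j = z 0 (widen_ord (isT : (7 <= 10)%N) j).
  rewrite mxE (bigD1 (widen_ord (isT : (7 <= 10)%N) j)) //= mxE eqxx mulr1 big1 ?addr0 // => i ij.
  rewrite mxE; case: eqP => [e|_]; last by rewrite mulr0.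
  by case/negP: ij; apply/eqP/val_inj.
split=> [z0|z0].
  apply/rowP => k; rewrite !mxE; case: ifP => // k7.
  by have := E (Ordinal k7); rewrite z0 mxE => ->; congr (z 0 _); apply: val_inj.
apply/rowP => j; rewrite E mxE.
have := congr1 (fun w : 'rV[R]_10 => w 0 (widen_ord (isT : (7 <= 10)%N) j)) z0.
by rewrite !mxE /= ltn_ord.
Qed.

Lemma Ck_on_subset (R : realType) (V W : normedModType R) k (U U' : set V) (f : V -> W) :
  U `<=` U' -> Ck_on k U' f -> Ck_on k U f.
Proof.
move=> UU'; elim: k f => [|k IH] f [fc fd]; (split; first by move=> x /UU'; exact: fc); first by [].
move=> v;  have [fd1 fd2] := fd v; split=> [x /UU'|]; [exact: fd1|exact: IH].
Qed.

Section geodesic_in_chart.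
Variables (R : realType) (U : set 'rV[R]_7) (sigma : 'rV[R]_7 -> 'M[R[i]]_4).
Hypothesis hchart : is_chart U sigma.

(** A chart is injective on cosets, so a curve of V_1 has only one coordinate
    expression; this transfers smoothness and the geodesic equation from the
    expression given by the definition of a geodesic to any other one. *)
Lemma coord_curve_unique (gamma : R -> set 'M[R[i]]_4) W W' c c' s :
  coord_curve U sigma gamma W c -> coord_curve U sigma gamma W' c' ->
  W s -> W' s -> c s = c' s.
Proof.
move=> [_ H] [_ H'] Ws Ws'; have [Uc E] := H s Ws; have [Uc' E'] := H' s Ws'.
by case: hchart => _ _ _ _; apply=> //; rewrite -E -E'.
Qed.
End geodesic_in_chart.

Unset Implicit Arguments.
Theorem proposition3p2 (R : realType) (J : set R) (gamma : R -> set 'M[R[i]]_4)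
    (hJopen : open J) (hJint : is_interval J) (hJ0 : J 0)
    (hgeo : unit_speed_geodesic J gamma) (h0 : gamma 0 = @base_point R)
    (U : set 'rV[R]_7) (sigma : 'rV[R]_7 -> 'M[R[i]]_4)
    (hchart : is_chart U sigma)
    (G : 'rV[R]_7 -> 'rV[R]_7 -> 'rV[R]_7 -> 'rV[R]_7)
    (hG : levi_civita U (metric sigma) G)
    (W : set R) (c : R -> 'rV[R]_7)
    (hW0 : W 0) (hc : coord_curve U sigma gamma W c) :
  (forall n : nat, (1 <= n)%N -> forall u : 'rV[R]_7,
     jacobi_op G c (2 * n) 0 u = (-1) ^+ (n - 1) *: jacobi_op G c 2 0 u) /\
  (forall n : nat, forall u : 'rV[R]_7,
     jacobi_op G c (2 * n + 1) 0 u = (-1) ^+ n *: jacobi_op G c 1 0 u).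
Proof.
have [oW cW] := hc; have [Uc0 gc0] := cW 0 hW0.
have [_ /(_ U sigma (c 0) hchart Uc0 gc0)] := hgeo 0 hJ0.
move=> [W' [c' [W'0 hc' sc' geo' speed']]]; have [oW' cW'] := hc'.
(* On X the curve c agrees with the expression c' given by hgeo. *)
pose X := W `&` W'.
have oX : open X by exact: openI.
have cc' s : X s -> c' s = c s.
  by case=> Ws W's; exact: esym (coord_curve_unique hchart hc hc' Ws W's).
have sc'X : smooth_on X c' by move=> k; apply: Ck_on_subset (sc' k) => s [].
have sc : smooth_on X c by exact: smooth_on_ext oX cc' sc'X.
have dcc s : X s -> derive1 c' s = derive1 c s.
  by move=> Xs; rewrite !derive1E; exact/near_eq_derive/(open_eq_near oX Xs cc').
have sdc : smooth_on X (derive1 c).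
  have -> : derive1 c = (fun s => 'D_1 c s) by apply/funext => s; rewrite derive1E.
  exact: smooth_on_derive.
have geo s : X s -> covDt G c (derive1 c) s = 0.
  move=> Xs; apply: (etrans _ (geo' G hG s Xs.2)).
  have E1 : derive1 (derive1 c) s = derive1 (derive1 c') s.
    rewrite (derive1E (derive1 c)) (derive1E (derive1 c')).
    by apply/esym/near_eq_derive; exact: (open_eq_near oX Xs dcc).
  have E2 a a' p p' : a = a' -> p = p' -> G a p p = G a' p' p' by move=> -> ->.
  exact: (congr2 (fun a b => a + b) E1 (E2 _ _ _ _ (esym (cc' s Xs)) (esym (dcc s Xs)))).
have mc := chart_maurer_cartan hchart.
have LC := hG; rewrite metric_dot in LC.
have X0 : X 0 by [].
have v1 : dot (vel pm7 (om sigma) c 0) (vel pm7 (om sigma) c 0) = 1.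
  have E a a' p p' : a = a' -> p = p' -> metric sigma a p p = metric sigma a' p' p' by move=> -> ->.
  apply: (etrans _ (etrans (E _ _ _ _ (esym (cc' 0 X0)) (esym (dcc 0 X0))) (speed' 0 W'0))).
  by rewrite metric_dot.
split=> [[//|n] _ u|n u].
  rewrite subn1 /=.
  exact: (jacobi_even brk_naturally_reductive mc (proj7_ker (R := R)) LC oX
    (fun s Xs => (cW s Xs.1).1) (fun s Xs => smooth_on_derivable sc Xs)
    (fun s Xs => smooth_on_derivable sdc Xs) geo (@pm7_cross R) n u X0 v1).
exact: (jacobi_odd brk_naturally_reductive mc (proj7_ker (R := R)) LC oX
    (fun s Xs => (cW s Xs.1).1) (fun s Xs => smooth_on_derivable sc Xs)
    (fun s Xs => smooth_on_derivable sdc Xs) geo (@pm7_cross R) n u X0 v1).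
Qed.
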